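(* For $p>1$, let $\mu_p$ be the lift of Lebesgue measure on $[0,1]$ to the curve $\{(x,x^p):x\in[0,1]\}\subseteq\mathbb{R}^2$ via the map $x\mapsto(x,x^p)$. Then, for all $\theta\in[0,1]$, \[ \dim_{\mathrm F}^{\theta}\mu_p=\min\left\{\frac{2}{p}+\theta\left(1-\frac1p\right),\ 1\right\}. \]
   Context: $\mu_p$ is the pushforward of Lebesgue measure on $[0,1]$ under $x\mapsto(x,x^p)$, regarded as a finite Borel measure on $\mathbb{R}^2$. For a finite Borel measure $\mu$ on $\mathbb{R}^2$ write $\widehat\mu(z)=\int e^{-2\pi i z\cdot x}\,d\mu(x)$. For $s\geq 0$ and $\theta\in(0,1]$ let $\mathcal{J}_{s,\theta}(\mu)=\left(\int_{\mathbb{R}^2}|\widehat\mu(z)|^{2/\theta}|z|^{s/\theta-2}\,dz\right)^{\theta}$, and let $\mathcal{J}_{s,0}(\mu)=\sup_{z\in\mathbb{R}^2}|\widehat\mu(z)|^2|z|^s$. The Fourier spectrum of $\mu$ at $\theta\in[0,1]$ is $\dim_{\mathrm F}^{\theta}\mu=\sup\{s\geq 0:\mathcal{J}_{s,\theta}(\mu)<\infty\}$, with $\sup\emptyset=0$. *)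

(* Defs.v *)
From HB Require Import structures.
From mathcomp Require Import all_boot all_order all_algebra.
From mathcomp Require Import all_classical all_reals all_analysis.
From mathcomp Require Import measurable_realfun complex.

Set Implicit Arguments.
Unset Strict Implicit.
Unset Printing Implicit Defensive.

Import Order.TTheory GRing.Theory Num.Theory.
Import numFieldNormedType.Exports.

Local Open Scope classical_set_scope.
Local Open Scope ring_scope.
Local Open Scope complex_scope.

(* The product sigma-algebra on this type is the Borel sigma-algebra of the
   plane. *)
Definition plane (R : realType) : measurableType _ :=
  (measurableTypeR R * measurableTypeR R)%type.

Section FourierSpectrum.
Context (R : realType).
Implicit Types (x z : plane R) (mu : {finite_measure set (plane R) -> \bar R}).

Definition dotp z x : R := z.1 * x.1 + z.2 * x.2.

(* The norm inherited by a product type in the library is the max norm. *)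
Definition enorm z : R := Num.sqrt (dotp z z).

Definition expi (t : R) : R[i] := cos t +i* sin t.

Definition Cintegral mu (f : plane R -> R[i]) : R[i] :=
  Rintegral mu setT (fun x => complex.Re (f x)) +i*
  Rintegral mu setT (fun x => complex.Im (f x)).

Definition fourier mu z : R[i] :=
  Cintegral mu (fun x => expi (- (2 * pi * dotp z x))).

Definition fourier_abs mu z : R := ComplexField.Normc.normc (fourier mu z).

(* With [powR], the factor [|z|^s] at [z = 0] is 1 when [s = 0] and 0 when
   [s > 0]. *)
Definition energy (s theta : R) mu : \bar R :=
  if theta == 0 then
    ereal_sup (range (fun z => (fourier_abs mu z ^+ 2 * enorm z `^ s)%:E))
  else
    poweR (\int[(lebesgue_measure \x lebesgue_measure)%E]_(z in [set: plane R])
      (fourier_abs mu z `^ (2 / theta) * enorm z `^ (s / theta - 2))%:E) theta.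

Definition fourier_spectrum (theta : R) mu : \bar R :=
  let S := [set s : R | 0 <= s /\ (energy s theta mu < +oo)%E] in
  if S == set0 then 0%E else ereal_sup (EFin @` S).

End FourierSpectrum.

Section LiftedMeasure.
Context (R : realType).

Lemma lebesgue_unit_lty :
  (lebesgue_measure (`[0%R, 1%R] : set (measurableTypeR R)) < +oo)%E.
Proof. by rewrite lebesgue_measure_itv/= lte_fin ltr01 -EFinB ltry. Qed.

Definition lebesgue01 : {finite_measure set (measurableTypeR R) -> \bar R} :=
  @mfrestr _ (measurableTypeR R) R _ lebesgue_measure
    (measurable_itv `[0%R, 1%R]) lebesgue_unit_lty.

Definition power_curve (p : R) (x : measurableTypeR R) : plane R :=
  (x, x `^ p).

Lemma measurable_power_curve (p : R) :
  measurable_fun [set: measurableTypeR R] (power_curve p).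
Proof.
by apply: measurable_fun_pair; [exact: measurable_id|exact: measurable_powR].
Qed.

Definition lift_lebesgue (p : R) : set (plane R) -> \bar R :=
  pushforward lebesgue01 (power_curve p).

Section instances.
Variable p : R.

Let mp : measurable_fun [set: measurableTypeR R] (power_curve p) :=
  measurable_power_curve p.

Let lift0 : lift_lebesgue p set0 = 0%E.
Proof. exact: measure0. Qed.

Let lift_ge0 A : (0 <= lift_lebesgue p A)%E.
Proof. exact: measure_ge0. Qed.

Let lift_sigma_additive : semi_sigma_additive (lift_lebesgue p).
Proof. exact: measure_semi_sigma_additive. Qed.

HB.instance Definition _ := isMeasure.Build _ _ _ (lift_lebesgue p)
  lift0 lift_ge0 lift_sigma_additive.

Let lift_fin : fin_num_fun (lift_lebesgue p).
Proof.
move=> A mA; apply: fin_num_measure.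
by rewrite -[X in measurable X]setTI; exact: mp.
Qed.

HB.instance Definition _ := Measure_isFinite.Build _ _ _ (lift_lebesgue p)
  lift_fin.

End instances.

End LiftedMeasure.

(* Main.v *)
(** Write [z = (xi, eta)] and let [mu^] be the Fourier transform of [mu_p].

    Energies are finite below the claimed value because of the pointwise bound
    [|mu^ z| <= C |z|^-u |xi|^-v], with [u = (1 - v) / q] and [q = max p 2],
    valid for all [v >= 0] with [2 v (q - 1) <= q - 2].  It comes from van der
    Corput's first and second derivative tests, splitting [[0, 1]] at
    [|eta|^(-1/p)] when [|xi| <= |eta|^(1/p)] and just before the stationary
    point otherwise.  Taking [v] just below [theta / 2] (or the largest
    admissible [v], if that is smaller) the energy integral is dominated by a
    product of one-dimensional power integrals.

    Energies are infinite above the claimed value by an averaging argument that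
    needs no pointwise lower bound.  Testing [|mu^|^2] against a product of two
    triangle functions on the box [[-A, A] x [-N, N]] turns it, by Tonelli, into
    a double integral of nonnegative Fejer kernels, which is at least a multiple
    of [A N (mu_p x mu_p)(|x - y| < 1 / A, |x^p - y^p| < 1 / N)].  Conversely
    the energy controls the same average through
    [X <= t + t^(1 - 1/theta) X^(1/theta)] with [X = |mu^ z|^2] and [t] a
    multiple of [|z|^-s].  Boxes with [A = N] give the bound [1], boxes with
    [A = N^(1/p)] give [2/p + theta (1 - 1/p)]. *)

Require Import Defs.
From HB Require Import structures.
From mathcomp Require Import all_boot all_order all_algebra.
From mathcomp Require Import all_classical all_reals all_analysis.
From mathcomp Require Import ring lra measurable_realfun complex.

Set Implicit Arguments.
Unset Strict Implicit.
Unset Printing Implicit Defensive.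

Import Order.TTheory GRing.Theory Num.Theory.
Import numFieldNormedType.Exports.

Local Open Scope classical_set_scope.
Local Open Scope ring_scope.

(** * Oscillatory integrals with phase [c + k x + h x^p] *)

(** The exponents come from matching. The weight [h^u |k|^v] is calibrated so that it agrees with
    the vertical rate [h^(1/q)] on [|k| = h^(1/q)], and the constraint on [v] keeps it below the
    stationary-phase rate [h^(1/2)] at [|k| ~ h]. In the energy, [|xi|^(-2v/theta)] has to be
    integrable across the axis [xi = 0], hence [2v < theta], and integrability at infinity asks for
    [s < 2u + 2v = 2/q + 2v(1 - 1/q)]. For [q = p] this tends to the claimed expression as [v] tends
    to [theta/2], and it equals [1] at the largest admissible [v]. For the converse, the box [A = N]
    sees a diagonal strip of area about [1/N], so [N] is compared with [N^(2-s)]. In the box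
    [A = N^(1/p)] all pairs of points of size about [1/A] are close in both coordinates, because the
    curve is flat at the origin; their area [A^(-2)] makes the left side [N^(1-1/p)]. On the right
    stand [tau A N^(1-s)] and [tau^(1-1/theta) N^(2-s)], which agree for
    [tau = N^(theta(1-1/p))]. *)

Section VanDerCorput.
Context {R : realType}.
Notation mu := (@lebesgue_measure R).

Lemma continuous_powR (a x : R) : 0 < x -> {for x, continuous (@powR R ^~ a)}.
Proof.
move=> x0; apply/differentiable_continuous/derivable1_diffP.
by apply: derivable_powR; rewrite in_itv/= x0.
Qed.

Lemma continuous_itv_integrable (f : R -> R) (a b : R) :
  {in `[a, b], continuous f} -> mu.-integrable `[a, b] (EFin \o f).
Proof.
move=> cf; apply: continuous_compact_integrable; first exact: segment_compact.
by apply: continuous_in_subspaceT => x /set_mem xab; exact: cf.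
Qed.

Lemma Rintegral_derive (f F : R -> R) (a b : R) : a <= b ->
  {in `[a, b], continuous f} ->
  (forall x : R, x \in `[a, b] -> is_derive x (1 : R) F (f x)) ->
  \int[mu]_(x in `[a, b]) f x = F b - F a.
Proof.
rewrite le_eqVlt => /predU1P[<- _ _|ab cf dF].
  by rewrite set_itv1 Rintegral_set1 subrr.
have cF x : x \in `[a, b] -> {for x, continuous F}.
  move=> xab; apply/differentiable_continuous/derivable1_diffP.
  by apply: ex_derive; exact: dF.
rewrite /Rintegral (@continuous_FTC2 _ f F)//.
- by apply: continuous_in_subspaceT => x /set_mem xab; exact: cf.
- split.
  + move=> x xab; apply: ex_derive; apply: dF.
    by move: xab; apply: subset_itvW.
  + by apply: cvg_at_right_filter; apply: cF; rewrite in_itv/= lexx ltW.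
  + by apply: cvg_at_left_filter; apply: cF; rewrite in_itv/= lexx ltW.
- move=> x xab; rewrite derive1E.
  have xab' : x \in `[a, b] by move: xab; apply: subset_itvW.
  by have := dF x xab' => -[_ ->].
Qed.

(** The free constant [c] lets one real integral replace a complex one: [c = 0] and [c = pi / 2]
    give the real and imaginary parts of the transform, and [c + pi] changes the sign, so upper
    bounds valid for every [c] are two-sided bounds. *)
Definition phase (c k h p x : R) := c + k * x + h * x `^ p.
Definition dphase (k h p x : R) := k + h * p * x `^ (p - 1).
Definition ddphase (h p x : R) := h * p * (p - 1) * x `^ (p - 2).

Lemma is_derive_phase (c k h p x : R) : 0 < x ->
  is_derive x (1 : R) (phase c k h p) (dphase k h p x).
Proof.
move=> x0; have hd := is_derive1_powR p x0.
rewrite /phase.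
apply: is_derive_eq.
rewrite /dphase /GRing.scale/=; ring.
Qed.

Lemma is_derive_dphase (k h p x : R) : 0 < x ->
  is_derive x (1 : R) (dphase k h p) (ddphase h p x).
Proof.
move=> x0; have hd := is_derive1_powR (p - 1) x0.
rewrite /dphase.
apply: is_derive_eq.
rewrite /ddphase /GRing.scale/= (_ : p - 1 - 1 = p - 2); ring.
Qed.

Lemma continuous_phase (c k h p x : R) : 0 < x -> {for x, continuous (phase c k h p)}.
Proof.
move=> x0; apply/differentiable_continuous/derivable1_diffP.
by apply: ex_derive; exact: is_derive_phase.
Qed.

Lemma continuous_dphase (k h p x : R) : 0 < x -> {for x, continuous (dphase k h p)}.
Proof.
move=> x0; apply/differentiable_continuous/derivable1_diffP.
by apply: ex_derive; exact: is_derive_dphase.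
Qed.

Lemma continuous_cos_phase (c k h p x : R) : 0 < x ->
  {for x, continuous (cos \o phase c k h p)}.
Proof.
move=> x0; apply: continuous_comp; first exact: continuous_phase.
exact: continuous_cos.
Qed.

(* Convexity of the phase gives [cos phi <= ((sin phi - 1) / phi')'], so that no
   integration by parts is needed. *)
Lemma van_der_corput_first (c k h p a b lam : R) : 1 < p -> 0 <= h -> 0 < a -> a <=
  b -> 0 < lam ->
  (forall x, a <= x <= b -> lam <= `|dphase k h p x|) ->
  \int[mu]_(x in `[a, b]) cos (phase c k h p x) <= 4 / lam.
Proof.
move=> p1 h0 a0 ab lam0 hlam.
pose G (x : R) : R := (sin (phase c k h p x) - 1) / dphase k h p x.
pose g (x : R) : R := cos (phase c k h p x) +
  (1 - sin (phase c k h p x)) * ddphase h p x / dphase k h p x ^+ 2.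
have pos x : x \in `[a, b] -> 0 < x.
  by rewrite in_itv/= => /andP[ax _]; exact: lt_le_trans ax.
have nz x : x \in `[a, b] -> dphase k h p x != 0.
  rewrite in_itv/= => /hlam; apply: contraTN => /eqP ->.
  by rewrite normr0 -ltNge.
have dG x : x \in `[a, b] -> is_derive x (1 : R) G (g x).
  move=> xab; have hd1 := is_derive_phase c k h p (pos _ xab).
  have hd2 := is_derive_dphase k h p (pos _ xab).
  have hd3 := is_deriveV (nz _ xab) hd2.
  have hd4 := @is_derive1_comp _ sin _ _ _ _ (is_derive_sin _) hd1.
  rewrite /G; apply: is_derive_eq.
  rewrite /g /GRing.scale/=; field; exact: nz.
have cg x : x \in `[a, b] -> {for x, continuous g}.
  move=> xab; have x0 := pos _ xab.
  apply: cvgD; first exact: continuous_cos_phase.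
  apply: cvgM; last first.
    apply: cvgV; first by rewrite expf_neq0// nz.
    by apply: cvgM; exact: continuous_dphase.
  apply: cvgM.
    apply: cvgB; first exact: cvg_cst.
    apply: (@continuous_comp _ _ _ (phase c k h p) sin).
      exact: continuous_phase.
    exact: continuous_sin.
  by apply: cvgM; [exact: cvg_cst|exact: continuous_powR].
apply: (@le_trans _ _ (\int[mu]_(x in `[a, b]) g x)).
  apply: le_Rintegral => //.
  - by apply: continuous_itv_integrable => x xab; apply: continuous_cos_phase;
    exact: pos.
  - exact: continuous_itv_integrable.
  - move=> x xab; rewrite /g lerDl.
    rewrite !mulr_ge0 ?subr_ge0 ?sin_le1 ?powR_ge0 ?invr_ge0 ?sqr_ge0//; lra.
rewrite (@Rintegral_derive _ G)//.
have bG x : a <= x <= b -> `|G x| <= 2 / lam.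
  move=> xab; rewrite /G normrM normfV.
  apply: ler_pM => //.
    have := sin_le1 (phase c k h p x); have := sin_geN1 (phase c k h p x).
    by rewrite ler_norml; lra.
  by rewrite lef_pV2 ?posrE ?hlam// (lt_le_trans lam0)// hlam.
have /(_ b) := bG; have /(_ a) := bG.
rewrite !lexx ab => /(_ isT) + /(_ isT).
rewrite !ler_norml (_ : 4 / lam = 2 / lam + 2/ lam); last by field; rewrite gt_eqF.
lra.
Qed.

End VanDerCorput.

Section VanDerCorput.
Context {R : realType}.
Notation mu := (@lebesgue_measure R).

Lemma measurable_phase (c k h p : R) : measurable_fun [set: R] (phase c k h p).
Proof.
apply: measurable_funD; last first.
  by apply: measurable_funM => //; exact: measurable_powR.
by apply: measurable_funD => //; exact: measurable_funM.
Qed.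

Lemma measurable_cos_phase (c k h p : R) :
  measurable_fun [set: R] (cos \o phase c k h p).
Proof.
apply: measurableT_comp; last exact: measurable_phase.
by apply: continuous_measurable_fun; exact: continuous_cos.
Qed.

Lemma integrable_le1 (D : set R) (f : R -> R) : measurable D ->
  (mu D < +oo)%E -> measurable_fun [set: R] f -> (forall x, `|f x| <= 1) ->
  mu.-integrable D (EFin \o f).
Proof.
move=> mD Doo mf f1; apply: measurable_bounded_integrable => //.
  exact: measurable_funTS.
by exists 1; split=> // M M1 x _ /=; rewrite (le_trans (f1 x))// ltW.
Qed.

Lemma cos_norm_le1 (x : R) : `|cos x| <= 1.
Proof. by rewrite ler_norml cos_geN1 cos_le1. Qed.

Lemma integrable_cos_phase (c k h p a b : R) :
  mu.-integrable `[a, b] (EFin \o (cos \o phase c k h p)).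
Proof.
apply: integrable_le1 => //; last by move=> x; exact: cos_norm_le1.
- by rewrite /= lebesgue_measure_itv; case: ifP => // _; rewrite -EFinB ltry.
- exact: measurable_cos_phase.
Qed.

Lemma Rintegral_split (f : R -> R) (a b c : R) : a <= c <= b ->
  mu.-integrable `[a, b] (EFin \o f) ->
  \int[mu]_(x in `[a, b]) f x =
  \int[mu]_(x in `[a, c]) f x + \int[mu]_(x in `[c, b]) f x.
Proof.
move=> /andP[ac cb] itf.
have := @Rintegral_itvB _ f (BLeft a) (BRight b) c itf.
rewrite !bnd_simp => /(_ ac cb) E.
rewrite -(@Rintegral_itv_obnd_cbnd _ c (BRight b)); first by rewrite -E addrC subrK.
apply: integrableS itf => //.
by move=> x; rewrite /= !in_itv/= => /andP[cx ->]; rewrite (le_trans ac (ltW cx)).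
Qed.

Lemma Rintegral_cos_le (c k h p a b : R) : a <= b ->
  \int[mu]_(x in `[a, b]) cos (phase c k h p x) <= b - a.
Proof.
move=> ab; apply: (@le_trans _ _ (\int[mu]_(x in `[a, b]) 1)).
  apply: le_Rintegral => //.
  - exact: integrable_cos_phase.
  - apply: (@integrable_le1 _ (cst 1)) => //=; last by move=> _; rewrite normr1.
    by rewrite /= lebesgue_measure_itv; case: ifP => // _; rewrite -EFinB ltry.
rewrite Rintegral_cst// mul1r /= lebesgue_measure_itv /= lte_fin.
by case: ltP => //=; rewrite subr_ge0.
Qed.

Section van_der_corput_second.
Variables (k h p a b kap : R).
Hypotheses (p1 : 1 < p) (h0 : 0 <= h) (a0 : 0 < a) (kap0 : 0 < kap).
Hypothesis hkap : forall x y, a <= x -> x <= y -> y <= b ->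
  kap * (y - x) <= dphase k h p y - dphase k h p x.

(** The length at which the trivial bound [t] and the first-derivative bound [4 / (kap * t)] are of
    the same order. *)
Let t : R := (Num.sqrt kap)^-1.

Let t0 : 0 < t. Proof. by rewrite invr_gt0 sqrtr_gt0. Qed.

Let kapt : kap * t = Num.sqrt kap.
Proof. by rewrite /t -{1}(sqr_sqrtr (ltW kap0)) expr2 mulfK// gt_eqF ?sqrtr_gt0. Qed.

(** Past [a' + t] the derivative has grown to at least [kap * t]; the first piece costs [t] and the
    rest [4 / (kap * t) = 4 * t]. *)
Lemma van_der_corput_second_pos c a' b' : a <= a' -> a' <= b' -> b' <= b ->
  0 <= dphase k h p a' ->
  \int[mu]_(x in `[a', b']) cos (phase c k h p x) <= 5 / Num.sqrt kap.
Proof.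
move=> aa ab bb d0; rewrite -/t; have tpos := t0.
have [le|lt] := leP b' (a' + t).
  by apply: le_trans (Rintegral_cos_le _ _ _ _ ab) _; lra.
have att : a' <= a' + t <= b' by apply/andP; split; lra.
rewrite (Rintegral_split att); last exact: integrable_cos_phase.
have /andP[at1 at2] := att.
rewrite (_ : 5 * t = t + 4 / (kap * t)); last by rewrite kapt /t; ring.
apply: lerD.
  by apply: le_trans (Rintegral_cos_le _ _ _ _ at1) _; lra.
apply: van_der_corput_first => //; [by rewrite addr_gt0// (lt_le_trans a0 aa)| |].
  by rewrite mulr_gt0.
move=> x /andP[x1 x2]; apply: le_trans (ler_norm _).
have := @hkap a' x aa (le_trans at1 x1) (le_trans x2 bb).
have : kap * t <= kap * (x - a') by rewrite ler_pM2l//; lra.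
lra.
Qed.

Lemma van_der_corput_second_neg c a' b' : a <= a' -> a' <= b' -> b' <= b ->
  dphase k h p b' <= 0 ->
  \int[mu]_(x in `[a', b']) cos (phase c k h p x) <= 5 / Num.sqrt kap.
Proof.
move=> aa ab bb d0; rewrite -/t; have tpos := t0.
have [le|lt] := leP b' (a' + t).
  by apply: le_trans (Rintegral_cos_le _ _ _ _ ab) _; lra.
have att : a' <= b' - t <= b' by apply/andP; split; lra.
rewrite (Rintegral_split att); last exact: integrable_cos_phase.
have /andP[at1 at2] := att.
rewrite (_ : 5 * t = 4 / (kap * t) + t); last by rewrite kapt /t; ring.
apply: lerD; last first.
  by apply: le_trans (Rintegral_cos_le _ _ _ _ at2) _; lra.
apply: van_der_corput_first => //; [exact: lt_le_trans a0 aa| |].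
  by rewrite mulr_gt0.
move=> x /andP[x1 x2]; rewrite -normrN; apply: le_trans (ler_norm _).
have := @hkap x b' (le_trans aa x1) (le_trans x2 at2) bb.
have : kap * t <= kap * (b' - x) by rewrite ler_pM2l//; lra.
lra.
Qed.

(** The derivative increases, so cutting at its zero, if there is one, leaves two pieces of constant
    sign, each costing [5 / sqrt kap]. *)
Lemma van_der_corput_second c : a <= b ->
  \int[mu]_(x in `[a, b]) cos (phase c k h p x) <= 10 / Num.sqrt kap.
Proof.
move=> ab; have t5 : 5 / Num.sqrt kap <= 10 / Num.sqrt kap.
  by rewrite ler_pM2r//; lra.
have [d0|d0] := leP 0 (dphase k h p a).
  by apply: le_trans t5; exact: van_der_corput_second_pos.
have [d1|d1] := leP (dphase k h p b) 0.
  by apply: le_trans t5; exact: van_der_corput_second_neg.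
have [||e eab e0] := @IVT _ (dphase k h p) a b 0 ab.
- apply: continuous_in_subspaceT => x /set_mem/=; rewrite in_itv/= => /andP[ax _].
  by apply: continuous_dphase; exact: lt_le_trans ax.
- by rewrite /Num.min /Num.max (lt_trans d0 d1) !ltW.
move: eab; rewrite in_itv/= => aeb; have /andP[ae eb] := aeb.
rewrite (Rintegral_split aeb); last exact: integrable_cos_phase.
rewrite (_ : 10 / _ = 5 / Num.sqrt kap + 5 / Num.sqrt kap); last by ring.
apply: lerD; first by apply: van_der_corput_second_neg => //; rewrite e0.
by apply: van_der_corput_second_pos => //; rewrite e0.
Qed.

End van_der_corput_second.

End VanDerCorput.

(** * Decay of the oscillatory integral over the unit interval *)

Section Decay.
Context {R : realType}.
Notation mu := (@lebesgue_measure R).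

Lemma powRE (x a : R) : 0 < x -> x `^ a = expR (a * ln x).
Proof. by move=> x0; rewrite /powR gt_eqF. Qed.

(** By the mean value theorem, a lower bound [m] for [t^(p - 2)] yields the growth hypothesis of the
    second-derivative test. *)
Lemma dphase_increment (k h p a b m x y : R) : 1 < p -> 0 <= h -> 0 < a ->
  (forall t, a < t < b -> m <= t `^ (p - 2)) ->
  a <= x -> x <= y -> y <= b ->
  h * p * (p - 1) * m * (y - x) <= dphase k h p y - dphase k h p x.
Proof.
move=> p1 h0 a0 hm ax; rewrite le_eqVlt => /predU1P[<-|xy] yb.
  by rewrite !subrr mulr0.
have [||z] := @MVT _ (dphase k h p) (ddphase h p) x y xy.
- move=> z; rewrite in_itv/= => /andP[xz zy]; apply: is_derive_dphase.
  by rewrite (lt_trans a0)// (le_lt_trans ax).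
- apply: continuous_in_subspaceT => z /set_mem/=; rewrite in_itv/= => /andP[xz _].
  by apply: continuous_dphase; rewrite (lt_le_trans a0)// (le_trans ax).
rewrite in_itv/= => /andP[xz zy] ->.
rewrite ler_pM2r ?subr_gt0// /ddphase ler_wpM2l//.
  by rewrite !mulr_ge0//; lra.
by apply: hm; rewrite (le_lt_trans ax xz) (lt_le_trans zy yb).
Qed.

Definition oscint (c k h p : R) : R :=
  \int[mu]_(x in `[0, 1]) cos (phase c k h p x).

Lemma oscint_le1 c k h p : oscint c k h p <= 1.
Proof. by apply: le_trans (Rintegral_cos_le _ _ _ _ _) _ => //; lra. Qed.

Lemma oscint_tail_le (c k h p d m : R) : 1 < p -> 0 < h -> 0 < d -> d <= 1 -> 0 < m ->
  (forall t, d < t < 1 -> m <= t `^ (p - 2)) ->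
  \int[mu]_(x in `[d, 1]) cos (phase c k h p x)
    <= 10 / Num.sqrt (h * p * (p - 1) * m).
Proof.
move=> p1 h0 d0 d1 m0 hm; apply: van_der_corput_second => //; first exact: ltW.
  by rewrite !mulr_gt0//; lra.
by move=> x y dx xy y1; apply: (@dphase_increment _ _ _ d 1) => //; exact: ltW.
Qed.

Lemma oscint_split (c k h p d : R) : 0 <= d <= 1 ->
  oscint c k h p = \int[mu]_(x in `[0, d]) cos (phase c k h p x) +
                   \int[mu]_(x in `[d, 1]) cos (phase c k h p x).
Proof.
by move=> d01; apply: Rintegral_split => //; exact: integrable_cos_phase.
Qed.

(** Up to [d] the power term contributes at most [|k| / 2] to the derivative, which therefore stays
    at least [|k| / 2] in absolute value. *)
Lemma oscint_head_le (c k h p d : R) : 1 < p -> 0 <= h -> 0 < d -> k != 0 ->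
  h * p * d `^ (p - 1) <= `|k| / 2 ->
  \int[mu]_(x in `[0, d]) cos (phase c k h p x) <= 8 / `|k|.
Proof.
(* The first-derivative test needs a positive left endpoint, so a piece [[0, e']] of length at most
   [e] is cut off and bounded trivially. *)
move=> p1 h0 d0 k0 hd; apply/ler_addgt0Pr => e e0.
have nk : 0 < `|k| by rewrite normr_gt0.
set e' := Num.min e d.
have e'0 : 0 < e' by rewrite lt_min e0 d0.
have e'd : e' <= d by rewrite ge_min lexx orbT.
have e'e : e' <= e by rewrite ge_min lexx.
rewrite (@Rintegral_split _ _ _ _ e'); last 2 first.
- by rewrite (ltW e'0).
- exact: integrable_cos_phase.
rewrite addrC lerD//.
  rewrite (_ : 8 / `|k| = 4 / (`|k| / 2)); last by field; rewrite gt_eqF.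
  apply: van_der_corput_first => //; first by rewrite divr_gt0.
  move=> x /andP[ex xd].
  have x0 : 0 < x by exact: lt_le_trans ex.
  have : h * p * x `^ (p - 1) <= `|k| / 2.
    apply: le_trans hd; rewrite ler_wpM2l// ?mulr_ge0//; first by lra.
    by rewrite ge0_ler_powR// ?nnegrE; lra.
  have : 0 <= h * p * x `^ (p - 1) by rewrite !mulr_ge0 ?powR_ge0//; lra.
  rewrite /dphase => A B.
  have := lerB_normD k (h * p * x `^ (p - 1)).
  rewrite (ger0_norm A); lra.
by apply: le_trans (Rintegral_cos_le _ _ _ _ _) _ => //; lra.
Qed.

Lemma oscint_first (c k h p : R) : 1 < p -> 0 <= h -> k != 0 ->
  2 * p * h <= `|k| -> oscint c k h p <= 8 / `|k|.
Proof.
move=> p1 h0 k0 hk; apply: oscint_head_le => //.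
by rewrite powR1; lra.
Qed.

(** For [p <= 2] one has [t^(p - 2) >= 1] on the unit interval, so the second derivative is bounded
    below all the way down to the origin. *)
Lemma oscint_second_le2 (c k h p : R) : 1 < p -> p <= 2 -> 0 < h ->
  oscint c k h p <= 10 / Num.sqrt (h * p * (p - 1)).
Proof.
move=> p1 p2 h0; apply/ler_addgt0Pr => e e0.
set d := Num.min e 1.
have d0 : 0 < d by rewrite lt_min e0 ltr01.
have d1 : d <= 1 by rewrite ge_min lexx orbT.
have de : d <= e by rewrite ge_min lexx.
rewrite (@oscint_split _ _ _ _ d) ?(ltW d0)// addrC lerD//.
  rewrite -[h * p * (p - 1)]mulr1; apply: oscint_tail_le => // t /andP[dt t1].
  have t0 : 0 < t by exact: lt_trans dt.
  rewrite powRE// -[leLHS]expR0 ler_expR.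
  by rewrite mulr_le0 ?subr_le0 ?ln_le0 ?(ltW t1).
by apply: le_trans (Rintegral_cos_le _ _ _ _ _) _; lra.
Qed.

Lemma oscint_second_ge2 (c k h p d : R) : 2 <= p -> 0 < h -> 0 < d -> d <= 1 ->
  \int[mu]_(x in `[d, 1]) cos (phase c k h p x)
    <= 10 / Num.sqrt (h * p * (p - 1) * d `^ (p - 2)).
Proof.
move=> p2 h0 d0 d1; apply: oscint_tail_le => //; [lra|exact: powR_gt0|].
move=> t /andP[dt t1]; rewrite ge0_ler_powR ?nnegrE//; first lra.
- exact: ltW.
- by rewrite ltW// (lt_trans d0).
- exact: ltW.
Qed.

(** Reduces power estimates to linear inequalities between logarithms. *)
Lemma invsqrt_expR (x K : R) : expR (2 * x) <= K -> (Num.sqrt K)^-1 <= expR (- x).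
Proof.
move=> xK; rewrite expRN lef_pV2 ?posrE ?expR_gt0//; last first.
  by rewrite sqrtr_gt0; apply: lt_le_trans xK; exact: expR_gt0.
rewrite -(@ger0_norm _ (expR x)) ?expR_ge0// -sqrtr_sqr ler_wsqrtr//.
by rewrite expr2 -expRD (_ : x + x = 2 * x)//; ring.
Qed.

(** For [h > 1] the cut [d = h^(-1/p)] equalizes the two costs: the head has length [d], and
    [h * d^(p - 2) = d^(-2)] makes the tail at most [10 * d]. *)
Lemma oscint_vertical_ge2 (c k h p : R) : 2 <= p -> 0 < h ->
  oscint c k h p <= 11 * h `^ (- p^-1).
Proof.
move=> p2 h0; have p0 : 0 < p by lra.
have pV : 0 < p^-1 by rewrite invr_gt0.
have [h1|h1] := leP h 1.
  apply: le_trans (oscint_le1 _ _ _ _) _.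
  have : 1 <= h `^ (- p^-1).
    rewrite powRE// -[leLHS]expR0 ler_expR mulNr oppr_ge0 pmulr_rle0//.
    exact: ln_le0.
  lra.
have l0 : 0 < ln h by rewrite ln_gt0.
set d := h `^ (- p^-1).
have d0 : 0 < d by exact: powR_gt0.
have d1 : d <= 1.
  by rewrite /d powRE// -expR0 ler_expR; nra.
rewrite (@oscint_split _ _ _ _ d) ?(ltW d0)//.
rewrite (_ : 11 * d = d + 10 * d); last by ring.
apply: lerD.
  by apply: le_trans (Rintegral_cos_le _ _ _ _ _) _; lra.
apply: le_trans (oscint_second_ge2 _ _ p2 h0 d0 d1) _.
rewrite ler_pM2l// [leRHS](_ : d = expR (- (p^-1 * ln h))); last first.
  by rewrite /d powRE// mulNr.
apply: invsqrt_expR.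
have -> : expR (2 * (p^-1 * ln h)) = h * d `^ (p - 2).
  rewrite /d -powRrM powRE// -{2}(lnK h0) -expRD; congr expR.
  by field; rewrite gt_eqF.
rewrite ler_wpM2r ?powR_ge0// -mulrA ler_peMr//; first exact: ltW.
nra.
Qed.

Lemma oscint_oblique (c k h p d : R) : 2 <= p -> 0 < h -> 0 < d -> d <= 1 -> k != 0 ->
  h * p * d `^ (p - 1) <= `|k| / 2 ->
  oscint c k h p <= 8 / `|k| + 10 / Num.sqrt (h * d `^ (p - 2)).
Proof.
move=> p2 h0 d0 d1 k0 hd.
rewrite (@oscint_split _ _ _ _ d) ?(ltW d0)//.
apply: lerD; first by apply: oscint_head_le => //; [lra|exact: ltW].
apply: le_trans (oscint_second_ge2 _ _ p2 h0 d0 d1) _.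
rewrite ler_pM2l// lef_pV2 ?posrE ?sqrtr_gt0 ?mulr_gt0 ?powR_gt0//; [|lra|lra].
rewrite ler_wsqrtr// ler_wpM2r ?powR_ge0// -mulrA ler_peMr//; first exact: ltW.
nra.
Qed.

End Decay.

(** * A decay bound uniform over all directions *)

Section Uniform.
Context {R : realType}.
Variables p : R.
Hypothesis p1 : 1 < p.
Let q : R := Num.max p 2.

Let q2 : 2 <= q. Proof. by rewrite le_max lexx orbT. Qed.
Let q0 : 0 < q. Proof. exact: lt_le_trans q2. Qed.

Lemma oscint_vertical : exists2 C : R, 0 < C &
  forall c k h : R, 0 < h -> oscint c k h p <= C * h `^ (- q^-1).
Proof.
have P1 := p1.
have [p2|p2] := leP p 2.
  exists (10 / Num.sqrt (p * (p - 1))).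
    by rewrite divr_gt0// sqrtr_gt0 mulr_gt0//; lra.
  move=> c k h h0; apply: le_trans (oscint_second_le2 _ _ p1 p2 h0) _.
  rewrite (_ : q = 2); last by rewrite /q max_r.
  rewrite powRN powR12_sqrt ?(ltW h0)// -[h * p * _]mulrA sqrtrM ?(ltW h0)//.
  by rewrite invfM (mulrC (Num.sqrt h)^-1) mulrA.
exists 11 => // c k h h0; rewrite (_ : q = p); last by rewrite /q max_l// ltW.
by apply: oscint_vertical_ge2 => //; exact: ltW.
Qed.

Variable v : R.
Hypotheses (v0 : 0 <= v) (vq : 2 * v * (q - 1) <= q - 2).
(** Equivalently [u + v / q = 1 / q], while [vq] amounts to [u + v <= 1/2]. *)
Let u : R := (1 - v) / q.

Let v12 : v < 2^-1.
Proof.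
have h1 := vq; have h2 := q2; have V0 := v0; rewrite ltNge; apply/negP => h3.
have : 0 <= (v - 2^-1) * (q - 1) by rewrite mulr_ge0 ?subr_ge0//; lra.
lra.
Qed.

Let u0 : 0 < u. Proof. by rewrite divr_gt0// subr_gt0; have h := v12; lra. Qed.

Let quv : q * u = 1 - v.
Proof. by rewrite /u mulrC mulfVK// gt_eqF. Qed.

Let uv1 : u + v <= 1.
Proof.
have h1 := quv; have h2 := q2; have V0 := v0; have h3 := u0.
have : 0 <= (q - 1) * u by rewrite mulr_ge0 ?(ltW h3)//; lra.
lra.
Qed.

Lemma oscint_oblique_ge2 (c k h : R) : 2 <= p -> 0 < h -> k != 0 ->
  `|k| <= 2 * p * h -> ln h / q <= ln `|k| ->
  oscint c k h p * expR (u * ln h + v * ln `|k|) <= 8 + 10 * (2 * p).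
Proof.
have P1 := p1; have V0 := v0; have VQ := vq; have U0 := u0; have Q2 := q2;
  have V12 := v12; have UV1 := uv1.
move=> p2 h0 k0 kh hk.
have nk : 0 < `|k| by rewrite normr_gt0.
have p0 : 0 < p by lra.
have qp : q = p by rewrite /q max_l.
(* Here [h p d^(p - 1) = |k| / 2], whereas a stationary point would need [|k|]; so [d] lies just
   before it. *)
pose d := (`|k| / (2 * p * h)) `^ (p - 1)^-1.
have r0 : 0 < `|k| / (2 * p * h) by rewrite divr_gt0// !mulr_gt0.
have r1 : `|k| / (2 * p * h) <= 1 by rewrite ler_pdivrMr ?mul1r// !mulr_gt0.
have d0 : 0 < d by exact: powR_gt0.
have pp0 : 0 < (p - 1)^-1 by rewrite invr_gt0; lra.
have lnr : ln (`|k| / (2 * p * h)) = ln `|k| - ln h - ln (2 * p).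
  by rewrite ln_div ?posrE ?mulr_gt0// lnM ?posrE ?mulr_gt0//; ring.
have lnp0 : 0 <= ln (2 * p) by rewrite ln_ge0//; lra.
have d1 : d <= 1.
  rewrite /d powRE// -[leRHS]expR0 ler_expR pmulr_rle0//.
  exact: ln_le0.
have dp : d `^ (p - 1) = `|k| / (2 * p * h).
  by rewrite /d -powRrM mulVf ?powRr1// ?ltW// gt_eqF//; lra.
have hd : h * p * d `^ (p - 1) <= `|k| / 2.
  by rewrite dp le_eqVlt; apply/orP; left; apply/eqP; field; rewrite !gt_eqF.
have le := oscint_oblique c p2 h0 d0 d1 k0 hd.
apply: (@le_trans _ _ ((8 / `|k| + 10 / Num.sqrt (h * d `^ (p - 2))) *
    expR (u * ln h + v * ln `|k|))).
  by rewrite ler_wpM2r ?expR_ge0.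
(* From [h <= |k|^q] and [q u = 1 - v]; this absorbs the head term [8 / |k|]. *)
have ulh : u * ln h <= (1 - v) * ln `|k|.
  rewrite -quv (_ : u * ln h = q * u * (ln h / q)); last by field; rewrite gt_eqF.
  by rewrite ler_wpM2l// mulr_ge0 ?ltW.
rewrite mulrDl; apply: lerD.
  rewrite -mulrA ler_piMr//.
  rewrite -{1}(lnK nk) -expRN -expRD -[leRHS]expR0 ler_expR.
  by move: ulh; lra.
rewrite -mulrA ler_wpM2l//.
have hlp : expR (ln (2 * p)) = 2 * p by rewrite lnK// posrE mulr_gt0.
rewrite -hlp -ler_pdivlMr ?expR_gt0// -expRN -expRD -[X in expR X]opprK.
apply: invsqrt_expR.
rewrite /d -powRrM powRE// lnr -{2}(lnK h0) -expRD ler_expR.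
have pn : p - 1 != 0 by rewrite gt_eqF//; lra.
(* Up to a power of [2 p], [h * d^(p - 2)] is [h^(1 - a) |k|^a], and [vq] reads [2 v <= a]. *)
set a := (p - 1)^-1 * (p - 2).
have a1 : a <= 1 by rewrite /a mulrC ler_pdivrMr; lra.
have a2 : 2 * v <= a.
  by rewrite /a [leRHS]mulrC ler_pdivlMr; [move: vq; rewrite qp; lra|lra].
have a0 : 0 <= a by rewrite /a mulr_ge0 ?(ltW pp0)//; lra.
(* The surplus exponents of [h] and [|k|] have ratio [1 / q], so the assumption [ln h / q <= ln |k|]
   compares them exactly. *)
have ua : 2 * u - (1 - a) = (a - 2 * v) / q.
  rewrite /u /a qp; field; rewrite gt_eqF//= gt_eqF//; lra.
have : (2 * u - (1 - a)) * ln h <= (a - 2 * v) * ln `|k|.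
  rewrite ua (_ : _ / q * _ = (a - 2 * v) * (ln h / q)); last by ring.
  by rewrite ler_wpM2l// subr_ge0.
have : 0 <= (2 - a) * ln (2 * p) by rewrite mulr_ge0//; lra.
lra.
Qed.

(** For [|k| <= h^(1/q)] the vertical bound suffices, beyond it the oblique one takes over; for
    [p < 2] the vertical bound suffices throughout. *)
Lemma oscint_decay_steep : exists2 C : R, 0 < C &
  forall c k h : R, 0 < h -> `|k| <= 2 * p * h ->
  oscint c k h p * (h `^ u * `|k| `^ v) <= C.
Proof.
have P1 := p1; have V0 := v0; have VQ := vq; have U0 := u0; have Q2 := q2;
  have V12 := v12; have UV1 := uv1.
have [CA CA0 hA] := oscint_vertical.
exists (CA + (8 + 10 * (2 * p))); first by rewrite addr_gt0//; lra.
move=> c k h h0 kh.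
(* [powR 0 v] is [0] for [v != 0] and [1] for [v = 0]; only the latter case calls for decay. *)
have [k0|k0] := eqVneq k 0.
  rewrite k0 normr0.
  have [vE|vN] := eqVneq v 0; last by rewrite powR0 ?vN// !mulr0; lra.
  rewrite vE powRr0 mulr1 /u vE subr0 mul1r.
  apply: le_trans (ler_wpM2r _ (hA c 0 h h0)) _; first exact: powR_ge0.
  rewrite -mulrA -powRD ?addNr ?powRr0 ?mulr1; first lra.
  by apply/implyP => _; rewrite gt_eqF.
have nk : 0 < `|k| by rewrite normr_gt0.
have vert : u * ln h + v * ln `|k| <= ln h / q ->
    oscint c k h p * (h `^ u * `|k| `^ v) <= CA + (8 + 10 * (2 * p)).
  move=> H; rewrite !powRE// -expRD.
  apply: le_trans (ler_wpM2r _ (hA c k h h0)) _; first exact: expR_ge0.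
  rewrite -mulrA powRE// -expRD.
  apply: (@le_trans _ _ (CA * 1)); last lra.
  rewrite ler_wpM2l// ?(ltW CA0)// -[leRHS]expR0 ler_expR.
  by move: H; rewrite mulrC; lra.
have [le|lt] := leP (ln `|k|) (ln h / q).
  apply: vert; rewrite (_ : ln h / q = u * ln h + v * (ln h / q)); last first.
    by rewrite /u; field; rewrite gt_eqF.
  by rewrite lerD2l ler_wpM2l.
have [p2|p2] := leP 2 p.
  rewrite !powRE// -expRD; apply: le_trans (oscint_oblique_ge2 _ _ _ _ _ _) _ => //.
    exact: ltW.
  lra.
have qE : q = 2 by rewrite /q max_r// ltW.
(* With [q = 2] the constraint [vq] leaves no other choice, and [u] becomes the vertical exponent
   [1 / q]. *)
have vE : v = 0 by apply/eqP; rewrite eq_le v0 andbT; move: vq; rewrite qE; lra.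
by apply: vert; rewrite vE mul0r addr0 /u vE subr0 mul1r mulrC.
Qed.

(** If [|k| >= 2 p h], which includes [h = 0], the bound [8 / |k|] is enough for [|k| > 1] because
    [u + v <= 1], and for [|k| <= 1] every factor is at most [1]. Otherwise [|k| + h] is comparable
    to [h]. *)
Lemma oscint_decay : exists2 C : R, 0 < C &
  forall c k h : R, 0 <= h -> oscint c k h p * ((`|k| + h) `^ u * `|k| `^ v) <= C.
Proof.
have P1 := p1; have V0 := v0; have VQ := vq; have U0 := u0; have Q2 := q2;
  have V12 := v12; have UV1 := uv1.
have [C C0 hC] := oscint_decay_steep.
have u1 : u <= 1 by move: uv1 v0; lra.
(* As [u <= 1], a constant [a >= 1] inside the power costs at most [a] outside. *)
have powu (a b : R) : 1 <= a -> 0 <= b -> (a * b) `^ u <= a * b `^ u.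
  move=> a1 b0; rewrite powRM//; last lra.
  rewrite ler_wpM2r ?powR_ge0// powRE; last lra.
  rewrite -[leRHS](@lnK _ a) ?posrE; last lra.
  rewrite ler_expR ler_piMl ?ln_ge0//.
exists ((1 + 2 * p) * C + 16); first by rewrite addr_gt0 ?mulr_gt0//; lra.
move=> c k h h0.
have [neg|pos] := leP (oscint c k h p) 0.
  apply: (@le_trans _ _ 0).
    by rewrite mulr_le0_ge0 ?mulr_ge0 ?powR_ge0.
  by rewrite addr_ge0 ?mulr_ge0// ?ltW//; lra.
have [kh|kh] := leP (2 * p * h) `|k|; last first.
  have hp : 0 < h by rewrite lt_neqAle h0 andbT eq_sym; apply: contraTneq kh => ->;
    rewrite mulr0 -leNgt.
  apply: (@le_trans _ _ (oscint c k h p * ((1 + 2 * p) * (h `^ u * `|k| `^ v)))).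
    rewrite ler_wpM2l ?(ltW pos)// mulrA ler_wpM2r ?powR_ge0//.
    apply: le_trans (powu _ _ _ h0); last lra.
    by rewrite ge0_ler_powR ?nnegrE ?(ltW u0)//;
      [rewrite addr_ge0|rewrite mulr_ge0//; lra|lra].
  rewrite mulrCA (@le_trans _ _ ((1 + 2 * p) * C))//; last lra.
  by rewrite ler_wpM2l ?hC ?ltW//; lra.
apply: (@le_trans _ _ (oscint c k h p * (2 * (`|k| `^ u * `|k| `^ v)))).
  rewrite ler_wpM2l ?(ltW pos)// mulrA ler_wpM2r ?powR_ge0//.
  apply: le_trans (powu _ _ _ _) => //; last lra.
  rewrite ge0_ler_powR ?nnegrE ?(ltW u0)//; [exact: addr_ge0|].
  have hh : h <= 2 * p * h by rewrite ler_peMl//; lra.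
  by move: kh hh; lra.
apply: (@le_trans _ _ 16); last by rewrite lerDr mulr_ge0// ?ltW//; lra.
rewrite mulrCA (_ : 16 = 2 * 8); last by ring.
rewrite ler_wpM2l//.
have [k1|k1] := leP `|k| 1.
  apply: (@le_trans _ _ 1); last lra.
  rewrite -[leRHS]mulr1; apply: ler_pM;
    rewrite ?(ltW pos) ?oscint_le1 ?mulr_ge0 ?powR_ge0//.
  have pw1 (w : R) : 0 <= w -> `|k| `^ w <= 1.
    move=> w0; rewrite [leRHS](_ : 1 = 1 `^ w); last by rewrite powR1.
    by rewrite ge0_ler_powR ?nnegrE.
  by rewrite -[leRHS]mulr1; apply: ler_pM; rewrite ?powR_ge0 ?pw1 ?(ltW u0).
have nk : 0 < `|k| by lra.
have k0 : k != 0 by rewrite -normr_gt0.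
apply: le_trans (ler_wpM2r _ (oscint_first _ p1 h0 k0 kh)) _.
  by rewrite mulr_ge0 ?powR_ge0.
rewrite -mulrA ler_piMr// !powRE// -expRD -{1}(lnK nk) -expRN -expRD.
rewrite -[leRHS]expR0 ler_expR.
have : 0 < ln `|k| by rewrite ln_gt0.
by move: uv1; nra.
Qed.

End Uniform.

(** * The Fourier transform of the lifted measure *)

Section Transform.
Context {R : realType}.
Notation mu := (@lebesgue_measure R).
Notation mu01 := (@lebesgue01 R).
Notation TR := (measurableTypeR R).

Let mu01C : mu01 (~` `[0, 1]) = 0%E.
Proof. by rewrite /= /mfrestr /mrestr setICl measure0. Qed.

Let m01 : measurable (`[0, 1] : set TR). Proof. exact: measurable_itv. Qed.

Let mu01S (A : set TR) : measurable A -> A `<=` `[0, 1] -> mu01 A = mu A.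
Proof. by move=> mA A01; rewrite /= /mfrestr /mrestr setIidl. Qed.

Lemma integral_lebesgue01 (f : TR -> \bar R) : mu01.-integrable [set: TR] f ->
  (\int[mu01]_x f x = \int[mu]_(x in `[0%R, 1%R]) f x)%E.
Proof.
move=> intf; rewrite (@negligible_integral _ _ _ _ _ (~` (`[0, 1] : set TR)))//;
  last first.
  exact: measurableC.
rewrite setTD setCK; apply: eq_measure_integral => A mA A01; exact: mu01S.
Qed.

Lemma lebesgue01T : mu01 [set: TR] = 1%E.
Proof.
rewrite /= /mfrestr /mrestr setTI.
by rewrite lebesgue_measure_itv /= lte_fin ltr01 -EFinB subr0.
Qed.

Lemma lebesgue01_lty : (mu01 [set: TR] < +oo)%E.
Proof. by rewrite lebesgue01T ltry. Qed.

Lemma integrable_lebesgue01_cos_phase (c k h p : R) :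
  mu01.-integrable [set: TR] (EFin \o (cos \o phase c k h p)).
Proof.
apply: measurable_bounded_integrable => //.
- exact: lebesgue01_lty.
- exact: measurable_cos_phase.
- by exists 1; split=> // M M1 x _ /=; rewrite (le_trans (cos_norm_le1 _))// ltW.
Qed.

Lemma integral_lebesgue01_cos_phase (c k h p : R) :
  (\int[mu01]_x (cos (phase c k h p x))%:E = (oscint c k h p)%:E)%E.
Proof.
rewrite integral_lebesgue01; last exact: integrable_lebesgue01_cos_phase.
rewrite /oscint /Rintegral fineK//; apply: integrable_fin_num => //.
exact: integrable_cos_phase.
Qed.

Lemma integral_onepcos_phase (c k h p : R) :
  (\int[mu01]_x (1 + cos (phase c k h p x))%:E = (1 + oscint c k h p)%:E)%E.
Proof.
have i1 : mu01.-integrable [set: TR] (EFin \o cst (1 : R)).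
  apply: measurable_bounded_integrable => //; first exact: lebesgue01_lty.
  by exists 1; split=> // M M1 x _ /=; rewrite normr1 ltW.
under eq_integral do rewrite EFinD.
rewrite (integralD measurableT i1 (integrable_lebesgue01_cos_phase c k h p)).
rewrite [X in (X + _)%E](_ : _ = 1%E) ?integral_lebesgue01_cos_phase//.
rewrite [LHS](_ : _ = \int[mu01]_x cst 1%E x)%E// integral_cst// mul1e.
exact: lebesgue01T.
Qed.

Lemma Rintegral_lift_cos (c a b p : R) :
  Rintegral (@lift_lebesgue R p) setT (fun x : plane R => cos (c + (a * x.1 + b * x.2)))
  = oscint c a b p.
Proof.
rewrite /Rintegral.
have mc : measurable_fun [set: plane R] (fun x : plane R => (cos (c + (a * x.1 + b
  * x.2)))%:E).
  apply/measurable_EFinP; apply: (@measurableT_comp _ _ _ _ _ _ cos).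
    by apply: continuous_measurable_fun; exact: continuous_cos.
  by apply: measurable_funD => //; apply: measurable_funD; apply: measurable_funM.
rewrite (@integral_pushforward _ _ _ _ _ _ (measurable_power_curve p) _ _ _ mc)//;
  last first.
  rewrite preimage_setT.
  rewrite (_ : _ \o _ = EFin \o (cos \o phase c a b p)); last first.
    by apply/funext => x /=; rewrite /phase addrA.
  exact: integrable_lebesgue01_cos_phase.
rewrite preimage_setT -[RHS]/(fine (oscint c a b p)%:E) -integral_lebesgue01_cos_phase.
by congr fine; apply: eq_integral => x _ /=; rewrite /phase addrA.
Qed.

(** Reduces [h < 0] to [h >= 0], where the phase is convex. *)
Lemma oscintN (c k h p : R) : oscint (- c) (- k) (- h) p = oscint c k h p.
Proof.
apply: eq_Rintegral => x _; rewrite -[RHS]cosN /phase; congr cos; ring.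
Qed.

Lemma oscintDpi (c k h p : R) : oscint (c + pi) k h p = - oscint c k h p.
Proof.
rewrite -mulN1r -RintegralZl//; last exact: integrable_cos_phase.
apply: eq_Rintegral => x _; rewrite mulN1r -cosDpi /phase; congr cos; ring.
Qed.

Lemma fourier_absE (p : R) (z : plane R) : fourier_abs (@lift_lebesgue R p) z =
  Num.sqrt (oscint 0 (2 * pi * z.1) (2 * pi * z.2) p ^+ 2 +
            oscint (pi / 2) (2 * pi * z.1) (2 * pi * z.2) p ^+ 2).
Proof.
rewrite /fourier_abs /fourier /Cintegral /=; congr (Num.sqrt (_ ^+ 2 + _ ^+ 2)).
- rewrite -oscintN oppr0 -Rintegral_lift_cos; apply: eq_Rintegral => x _.
  by congr cos; rewrite /dotp; ring.
- rewrite -Rintegral_lift_cos; apply: eq_Rintegral => x _.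
  by rewrite sinN -cosDpihalf; congr cos; rewrite /dotp; ring.
Qed.

Lemma norm_oscint_le1 (c k h p : R) : `|oscint c k h p| <= 1.
Proof. by rewrite ler_norml oscint_le1 andbT lerNl -oscintDpi oscint_le1. Qed.

Lemma sqrt_sumsq_le (x y : R) : Num.sqrt (x ^+ 2 + y ^+ 2) <= `|x| + `|y|.
Proof.
rewrite -(@ger0_norm _ (`|x| + `|y|)) ?addr_ge0// -sqrtr_sqr ler_wsqrtr//.
rewrite sqrrD !real_normK ?num_real//.
by rewrite lerD2r lerDl mulrn_wge0 ?mulr_ge0.
Qed.

Lemma fourier_abs_le2 (p : R) (z : plane R) : fourier_abs (@lift_lebesgue R p) z <= 2.
Proof.
rewrite fourier_absE; apply: le_trans (sqrt_sumsq_le _ _) _.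
by rewrite (_ : 2 = 1 + 1)// lerD// norm_oscint_le1.
Qed.

Lemma fourier_abs_ge0 (p : R) (z : plane R) : 0 <= fourier_abs (@lift_lebesgue R p) z.
Proof. by rewrite fourier_absE sqrtr_ge0. Qed.

(** Tonelli gives measurability of parameter integrals of nonnegative functions, hence the detour
    through [1 + cos]. *)
Lemma measurable_oscint (c p : R) : measurable_fun [set: plane R]
  (fun z : plane R => oscint c (2 * pi * z.1) (2 * pi * z.2) p).
Proof.
pose f (w : plane R * TR) : \bar R :=
  (1 + cos (phase c (2 * pi * w.1.1) (2 * pi * w.1.2) p w.2))%:E.
have mf : measurable_fun [set: plane R * TR] f.
  apply/measurable_EFinP; apply: measurable_funD => //.
  apply: (@measurableT_comp _ _ _ _ _ _ cos).
    by apply: continuous_measurable_fun; exact: continuous_cos.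
  have m11 : measurable_fun [set: plane R * TR] (fun w => w.1.1).
    exact: (measurableT_comp measurable_fst measurable_fst).
  have m12 : measurable_fun [set: plane R * TR] (fun w => w.1.2).
    exact: (measurableT_comp measurable_snd measurable_fst).
  apply: measurable_funD; last first.
    apply: measurable_funM; first by apply: measurable_funM.
    exact: (measurableT_comp (measurable_powR _) measurable_snd).
  apply: measurable_funD => //; apply: measurable_funM => //.
  exact: measurable_funM.
have f0 w : (0 <= f w)%E.
  by rewrite lee_fin -lerBlDl sub0r; exact: cos_geN1.
have := measurable_fun_fubini_tonelli_F (m2 := mu01) f mf f0.
have FE z : fubini_F mu01 f z = (1 + oscint c (2 * pi * z.1) (2 * pi * z.2) p)%:E.
  exact: (integral_onepcos_phase c (2 * pi * z.1) (2 * pi * z.2) p).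
rewrite (_ : fubini_F _ _ = EFin \o (fun z : plane R => 1 + oscint c (2 * pi * z.1)
  (2 * pi * z.2) p)); last first.
  by apply/funext => z; rewrite FE.
move/measurable_EFinP => m1.
rewrite (_ : (fun _ => _) = (fun z : plane R =>
   (1 + oscint c (2 * pi * z.1) (2 * pi * z.2) p) - 1)); last first.
  by apply/funext => z; rewrite addrC addKr.
by apply: measurable_funB.
Qed.

Lemma measurable_fourier_abs (p : R) :
  measurable_fun [set: plane R] (fourier_abs (@lift_lebesgue R p)).
Proof.
rewrite (_ : fourier_abs _ = (fun z : plane R =>
  Num.sqrt (oscint 0 (2 * pi * z.1) (2 * pi * z.2) p ^+ 2 +
            oscint (pi / 2) (2 * pi * z.1) (2 * pi * z.2) p ^+ 2))); last first.
  by apply/funext => z; rewrite fourier_absE.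
apply: (@measurableT_comp _ _ _ _ _ _ (@Num.sqrt R)).
  by apply: continuous_measurable_fun; exact: sqrt_continuous.
by apply: measurable_funD; apply: measurable_funX; exact: measurable_oscint.
Qed.

Lemma measurable_enorm : measurable_fun [set: plane R] (@enorm R).
Proof.
apply: (@measurableT_comp _ _ _ _ _ _ (@Num.sqrt R)).
  by apply: continuous_measurable_fun; exact: sqrt_continuous.
by apply: measurable_funD; apply: measurable_funM.
Qed.

Lemma enorm_ge0 (z : plane R) : 0 <= enorm z.
Proof. exact: sqrtr_ge0. Qed.

Lemma enorm_le (z : plane R) : enorm z <= `|z.1| + `|z.2|.
Proof. by rewrite /enorm /dotp -!expr2; exact: sqrt_sumsq_le. Qed.

Lemma enorm_ge1 (z : plane R) : `|z.1| <= enorm z.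
Proof.
by rewrite /enorm /dotp -!expr2 -sqrtr_sqr ler_wsqrtr// lerDl sqr_ge0.
Qed.

Lemma enorm_ge2 (z : plane R) : `|z.2| <= enorm z.
Proof.
by rewrite /enorm /dotp -!expr2 -sqrtr_sqr ler_wsqrtr// lerDr sqr_ge0.
Qed.

Lemma fourier_decay (p v : R) : 1 < p -> 0 <= v ->
  2 * v * (Num.max p 2 - 1) <= Num.max p 2 - 2 ->
  exists2 C : R, 0 < C & forall z : plane R,
    fourier_abs (@lift_lebesgue R p) z *
      (enorm z `^ ((1 - v) / Num.max p 2) * `|z.1| `^ v) <= C.
Proof.
move=> p1 v0 vq; have [C C0 hC] := oscint_decay p1 v0 vq.
set u := (1 - v) / _ in hC *.
have u0 : 0 <= u.
  have q2 : 2 <= Num.max p 2 by rewrite le_max lexx orbT.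
  rewrite divr_ge0//; last by lra.
  rewrite subr_ge0 leNgt; apply/negP => v1.
  have : 0 <= (v - 1) * (Num.max p 2 - 1) by rewrite mulr_ge0//; lra.
  by move: vq v1 q2; lra.
have hC' c k h : `|oscint c k h p| * ((`|k| + `|h|) `^ u * `|k| `^ v) <= C.
  have aux c' k' h' : 0 <= h' ->
      `|oscint c' k' h' p| * ((`|k'| + `|h'|) `^ u * `|k'| `^ v) <= C.
    move=> h0; rewrite (ger0_norm h0).
    have [H|H] := leP 0 (oscint c' k' h' p); first by rewrite ger0_norm// hC.
    by rewrite ltr0_norm// -oscintDpi hC.
  have [h0|h0] := leP 0 h; first exact: aux.
  by rewrite -oscintN -(normrN k) -(normrN h); apply: aux; rewrite oppr_ge0 ltW.
have pi1 : 1 <= 2 * pi :> R by have := pi_ge2 R; lra.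
exists (C + C); first by rewrite addr_gt0.
move=> z; set k := 2 * pi * z.1; set h := 2 * pi * z.2.
have zk : `|z.1| <= `|k| by rewrite /k normrM ger0_norm ?ler_peMl//; lra.
have zh : `|z.2| <= `|h| by rewrite /h normrM ger0_norm ?ler_peMl//; lra.
apply: (@le_trans _ _ ((`|oscint 0 k h p| + `|oscint (pi / 2) k h p|) *
   ((`|k| + `|h|) `^ u * `|k| `^ v))).
  rewrite ler_pM ?mulr_ge0 ?powR_ge0 ?fourier_abs_ge0//.
    by rewrite fourier_absE; exact: sqrt_sumsq_le.
  apply: ler_pM; rewrite ?powR_ge0// ge0_ler_powR ?nnegrE ?enorm_ge0 ?addr_ge0//.
  by apply: le_trans (enorm_le _) _; exact: lerD.
by rewrite mulrDl lerD.
Qed.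

End Transform.

(** * Integrability of powers *)

Section PowerIntegrals.
Context {R : realType}.
Notation mu := (@lebesgue_measure R).
Notation TR := (measurableTypeR R).

Lemma ge0_integral_fold (f : TR -> \bar R) : measurable_fun [set: TR] f ->
  (forall x, 0 <= f x)%E ->
  (\int[mu]_x f x = \int[mu]_(x in `]0%R, +oo[) f x +
                    \int[mu]_(x in `]0%R, +oo[) f (- x)%R)%E.
Proof.
move=> mf f0.
have mfN : measurable_fun [set: TR] (fun x : TR => f (- x)).
  by apply: (measurableT_comp mf); apply: continuous_measurable_fun;
    exact: opp_continuous.
have -> : [set: TR] = `]-oo, 0%R] `|` `]0%R, +oo[.
  apply/seteqP; split=> x //= _; rewrite !in_itv/= andbT.
  by case: (leP x 0); [left|right].
rewrite ge0_integral_setU//; last 2 first.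
- exact: measurable_funTS.
- rewrite disj_set2E; apply/eqP; rewrite -subset0 => x/=.
  by rewrite !in_itv/= andbT => -[x0]; rewrite ltNge x0.
rewrite addeC; congr (_ + _)%E.
under eq_integral do rewrite -[X in f X]opprK.
rewrite -(@ge0_integration_by_substitution0 _ (fun x => f (- x)))//.
by rewrite -integral_itv_obnd_cbnd//; exact: measurable_funTS.
Qed.

Lemma ge0_integral_even (f : TR -> \bar R) : measurable_fun [set: TR] f ->
  (forall x, 0 <= f x)%E -> (forall x : R, f (- x) = f x) ->
  (\int[mu]_x f x = 2%:E * \int[mu]_(x in `]0%R, +oo[) f x)%E.
Proof.
move=> mf f0 fN; rewrite ge0_integral_fold//.
under [X in (_ + X)%E]eq_integral do rewrite fN.
by rewrite mule_natl mule2n.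
Qed.

Lemma integral_powR (a x y : R) : 0 < x -> x <= y -> a != 1 ->
  (\int[mu]_(t in `[x, y]) (t `^ (- a))%:E =
   ((y `^ (1 - a) - x `^ (1 - a)) / (1 - a))%:E)%E.
Proof.
move=> x0 xy a1.
have a10 : 1 - a != 0 by rewrite subr_eq0 eq_sym.
have pos t : t \in `[x, y] -> 0 < t.
  by rewrite in_itv/= => /andP[xt _]; exact: lt_le_trans xt.
have cf : {in `[x, y], continuous (fun t : R => t `^ (- a))}.
  by move=> t txy; apply: continuous_powR; exact: pos.
rewrite -[LHS]fineK; last first.
  by apply: integrable_fin_num => //; exact: continuous_itv_integrable.
congr EFin; rewrite mulrBl.
apply: (@Rintegral_derive _ _ (fun t => t `^ (1 - a) / (1 - a))) => // t txy.
have hd := is_derive1_powR (1 - a) (pos _ txy).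
apply: is_derive_eq.
rewrite /GRing.scale/= (_ : 1 - a - 1 = - a); last by ring.
by field.
Qed.

Lemma integral_bigcup_le (F : (set TR)^nat) (f : TR -> \bar R) (M : \bar R) :
  nondecreasing_seq F -> (forall i, measurable (F i)) ->
  measurable_fun [set: TR] f -> (forall x, 0 <= f x)%E ->
  (forall i, \int[mu]_(x in F i) f x <= M)%E ->
  (\int[mu]_(x in \bigcup_i F i) f x <= M)%E.
Proof.
move=> nF mF mf f0 FM.
have H : (\int[mu]_(x in F i) f x @[i --> \oo] --> \int[mu]_(x in \bigcup_i F i) f x)%E.
  by apply: ge0_nondecreasing_set_cvg_integral => // i; exact: measurable_funTS.
rewrite -(cvg_lim _ H)//; apply: lime_le; first by apply/cvg_ex; eexists; exact: H.
by near=> n; exact: FM.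
Unshelve. all: by end_near. Qed.

Lemma integral_powR_near0 (a : R) : a < 1 ->
  (\int[mu]_(t in `]0%R, 1%R]) (t `^ (- a))%:E <= ((1 - a)^-1)%:E)%E.
Proof.
move=> a1.
have -> : `]0%R, 1%R]%classic = \bigcup_i `[(i.+1%:R^-1 : R), 1]%classic.
  apply/seteqP; split=> x /=.
    rewrite in_itv/= => /andP[x0 x1].
    have [n nx] : exists n, x^-1 < n.+1%:R.
      have := archi_boundP (ltW (_ : 0 < x^-1)); rewrite invr_gt0 => /(_ x0) H.
      by exists (Num.bound x^-1); apply: lt_trans H _; rewrite ltr_nat.
    exists n => //=; rewrite in_itv/= x1 andbT -[x]invrK lef_pV2 ?posrE ?invr_gt0//.
    exact: ltW.
  move=> [n _]/=; rewrite !in_itv/= => /andP[nx ->]; rewrite andbT.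
  by apply: lt_le_trans nx; rewrite invr_gt0.
apply: integral_bigcup_le.
- apply/nondecreasing_seqP => n; rewrite subsetEset => x /=.
  rewrite !in_itv/= => /andP[nx ->]; rewrite andbT; apply: le_trans nx.
  by rewrite lef_pV2 ?posrE// ler_nat.
- by move=> i; exact: measurable_itv.
- by apply/measurable_EFinP; exact: measurable_powR.
- by move=> x; rewrite lee_fin powR_ge0.
- move=> i; rewrite integral_powR ?lt_eqF// ?invf_le1 ?ler1n//.
  rewrite lee_fin powR1 -[leRHS]mul1r ler_pM2r ?invr_gt0 ?subr_gt0// gerBl powR_ge0.
Qed.

Lemma integral_powR_infty (b : R) : 1 < b ->
  (\int[mu]_(t in `[1%R, +oo[) (t `^ (- b))%:E <= ((b - 1)^-1)%:E)%E.
Proof.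
move=> b1.
have -> : `[1%R, +oo[%classic = \bigcup_i `[1 : R, i.+1%:R]%classic.
  apply/seteqP; split=> x /=.
    rewrite in_itv/= andbT => x1.
    have [n nx] : exists n, x < n.+1%:R.
      have := archi_boundP (le_trans ler01 x1) => H.
      by exists (Num.bound x); apply: lt_trans H _; rewrite ltr_nat.
    by exists n => //=; rewrite in_itv/= x1/= ltW.
  by move=> [n _]/=; rewrite !in_itv/= => /andP[-> _].
apply: integral_bigcup_le.
- apply/nondecreasing_seqP => n; rewrite subsetEset => x /=.
  rewrite !in_itv/= => /andP[-> nx]/=; apply: le_trans nx _.
  by rewrite ler_nat.
- by move=> i; exact: measurable_itv.
- by apply/measurable_EFinP; exact: measurable_powR.
- by move=> x; rewrite lee_fin powR_ge0.
- move=> i; rewrite integral_powR ?gt_eqF ?ler1n//.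
  rewrite lee_fin powR1 (_ : _ / _ = (1 - i.+1%:R `^ (1 - b)) / (b - 1)).
    rewrite -[leRHS]mul1r ler_pM2r ?invr_gt0 ?subr_gt0// gerBl powR_ge0.
  by field; rewrite !subr_eq0 (gt_eqF b1) (lt_eqF b1).
Qed.

(* The value at 0 is infinite because [powR 0 (- a) = 0] when [a != 0], which
   would make [two_powers] useless as a majorant on the axes. *)
Definition two_powers (a b : R) (x : TR) : \bar R :=
  if x == 0 then +oo%E
  else if `|x| <= 1 then (`|x| `^ (- a))%:E else (`|x| `^ (- b))%:E.

Lemma two_powers_gt0 a b x : (0 < two_powers a b x)%E.
Proof.
rewrite /two_powers; case: ifPn => [_|x0]; first by rewrite ltry.
by case: ifP => _; rewrite lte_fin powR_gt0// normr_gt0.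
Qed.

Lemma measurable_two_powers a b : measurable_fun [set: TR] (two_powers a b).
Proof.
have mn : measurable_fun [set: TR] (fun x : TR => `|x|) by exact: normr_measurable.
apply: measurable_fun_ifT; [exact: measurable_fun_eqr|exact: measurable_cst|].
apply: measurable_fun_ifT; first exact: measurable_fun_ler.
  by apply/measurable_EFinP; exact: (measurableT_comp (measurable_powR _) mn).
by apply/measurable_EFinP; exact: (measurableT_comp (measurable_powR _) mn).
Qed.

Lemma integral_two_powers (a b : R) : a < 1 -> 1 < b ->
  (\int[mu]_x two_powers a b x < +oo)%E.
Proof.
move=> a1 b1; have mH := measurable_two_powers a b.
have H0 x : (0 <= two_powers a b x)%E by rewrite ltW// two_powers_gt0.
rewrite ge0_integral_even//; last by move=> x; rewrite /two_powers oppr_eq0 normrN.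
have -> : `]0%R, +oo[%classic = `]0 : R, 1]%classic `|` `]1 : R, +oo[%classic.
  by rewrite -itv_bndbnd_setU// bnd_simp.
rewrite ge0_integral_setU//; last 2 first.
- exact: measurable_funTS.
- rewrite disj_set2E; apply/eqP; rewrite -subset0 => x/=.
  by rewrite !in_itv/= andbT => -[/andP[_ x1]]; rewrite ltNge x1.
rewrite lte_mul_pinfty// lte_add_pinfty//.
- apply: le_lt_trans (le_lt_trans (integral_powR_near0 a1) (ltry _)).
  rewrite le_eqVlt; apply/orP; left; apply/eqP; apply: eq_integral => x.
  rewrite inE/= in_itv/= => /andP[x0 x1].
  by rewrite /two_powers gt_eqF// gtr0_norm// x1.
- apply: le_lt_trans (le_lt_trans (integral_powR_infty b1) (ltry _)).
  rewrite -integral_itv_obnd_cbnd; last first.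
    by apply/measurable_EFinP/measurable_funTS; exact: measurable_powR.
  rewrite le_eqVlt; apply/orP; left; apply/eqP; apply: eq_integral => x.
  rewrite inE/= in_itv/= andbT => x1.
  have x0 : 0 < x by exact: lt_trans x1.
  by rewrite /two_powers gt_eqF// gtr0_norm// leNgt x1.
Qed.

(** A substitute for [|x|^(-a)] on [[-N, N]] without the singularity at [0]. For [N = 1], [a = 0] it
    is the indicator of [[-1, 1]], used below to cover the unit disc. *)
Definition trunc_power (N a : R) (x : TR) : R :=
  if `|x| <= N then Num.max 1 `|x| `^ (- a) else 0.

Lemma trunc_power_ge0 N a x : 0 <= trunc_power N a x.
Proof. by rewrite /trunc_power; case: ifP => // _; exact: powR_ge0. Qed.

Lemma measurable_trunc_power N a : measurable_fun [set: TR] (trunc_power N a).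
Proof.
have mn : measurable_fun [set: TR] (fun x : TR => `|x|) by exact: normr_measurable.
apply: measurable_fun_ifT => //; first exact: measurable_fun_ler.
apply: (measurableT_comp (measurable_powR _)).
exact: measurable_maxr.
Qed.

Lemma integral_trunc_power (N a : R) : 1 <= N -> 0 <= a < 1 ->
  (\int[mu]_x (trunc_power N a x)%:E <= (2 / (1 - a) * N `^ (1 - a))%:E)%E.
Proof.
move=> N1 /andP[a0 a1]; have mH := measurable_trunc_power N a.
have mE : measurable_fun [set: TR] (EFin \o trunc_power N a) by exact/measurable_EFinP.
have H0 (x : TR) : (0 <= (trunc_power N a x)%:E)%E by rewrite lee_fin trunc_power_ge0.
rewrite ge0_integral_even//; last by move=> x; rewrite /trunc_power normrN.
have -> : `]0%R, +oo[%classic = `]0 : R, 1]%classic `|` (`]1 : R, N] `|` `]N, +oo[).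
  by rewrite -!itv_bndbnd_setU// bnd_simp.
rewrite ge0_integral_setU//; last 3 first.
- exact: measurableU.
- exact: measurable_funTS.
- rewrite disj_set2E; apply/eqP; rewrite -subset0 => x/=.
  rewrite !in_itv/= andbT => -[/andP[_ x1]] [/andP[]|]; rewrite ltNge ?x1//.
  by rewrite (le_trans x1).
rewrite ge0_integral_setU//; last 2 first.
- exact: measurable_funTS.
- rewrite disj_set2E; apply/eqP; rewrite -subset0 => x/=.
  by rewrite !in_itv/= andbT => -[/andP[_ x1]]; rewrite ltNge x1.
have -> : (\int[mu]_(x in `]0%R, 1%R]) (trunc_power N a x)%:E = 1)%E.
  rewrite (_ : 1%E = (\int[mu]_(x in `]0%R, 1%R]) cst 1%E x)%E); last first.
    rewrite integral_cst// mul1e /= lebesgue_measure_itv/= lte_fin ltr01.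
    by rewrite -EFinB subr0.
  apply: eq_integral => x; rewrite inE/= in_itv/= => /andP[x0 x1].
  rewrite /trunc_power gtr0_norm// (le_trans x1 N1) max_l//.
  by rewrite powR1.
have -> : (\int[mu]_(x in `]N, +oo[) (trunc_power N a x)%:E = 0)%E.
  apply: integral0_eq => x /=; rewrite in_itv/= andbT => Nx.
  rewrite /trunc_power gtr0_norm ?leNgt ?Nx//.
  exact: lt_trans (lt_le_trans _ N1) Nx.
have -> : (\int[mu]_(x in `]1%R, N]) (trunc_power N a x)%:E =
           ((N `^ (1 - a) - 1) / (1 - a))%:E)%E.
  rewrite (_ : N `^ (1 - a) - 1 = N `^ (1 - a) - 1 `^ (1 - a)); last first.
    by rewrite powR1.
  rewrite -integral_powR ?lt_eqF//.
  rewrite -integral_itv_obnd_cbnd; last first.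
    by apply/measurable_EFinP/measurable_funTS; exact: measurable_powR.
  apply: eq_integral => x; rewrite inE/= in_itv/= => /andP[x1 xN].
  have x0 : 0 < x by exact: lt_trans x1.
  by rewrite /trunc_power gtr0_norm// xN max_r// ltW.
rewrite adde0 -EFinD -EFinM lee_fin -mulrA ler_pM2l//.
(* The contribution [1] of []0, 1]] is at most the [1 / (1 - a)] subtracted on []1, N]], because
   [0 <= a]. *)
rewrite (_ : (1 - a)^-1 * _ = (N `^ (1 - a) - 1) / (1 - a) + (1 - a)^-1); last first.
  by field; lra.
rewrite addrC lerD2l -[leLHS]invr1 lef_pV2 ?posrE; lra.
Qed.

End PowerIntegrals.

(** * Finiteness of the energy *)

Section EnergyFinite.
Context {R : realType}.
Notation mu := (@lebesgue_measure R).
Notation TR := (measurableTypeR R).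
Notation fa p := (fourier_abs (@lift_lebesgue R p)).

Lemma integral_plane_prod (F G : TR -> \bar R) :
  measurable_fun [set: TR] F -> measurable_fun [set: TR] G ->
  (forall x, 0 <= F x)%E -> (forall x, 0 <= G x)%E ->
  (\int[(mu \x mu)%E]_(z in [set: plane R]) (F z.1 * G z.2) =
   (\int[mu]_x F x) * (\int[mu]_x G x))%E.
Proof.
move=> mF mG F0 G0.
rewrite fubini_tonelli1//=; last 2 first.
- apply: emeasurable_funM.
    exact: (measurableT_comp mF measurable_fst).
  exact: (measurableT_comp mG measurable_snd).
- by move=> z; rewrite mule_ge0.
rewrite /fubini_F/=.
under eq_integral do rewrite ge0_integralZl//.
rewrite ge0_integralZr//; apply: integral_ge0 => x _; exact: G0.
Qed.

Lemma gt0_powRD (x a b : R) : 0 < x -> x `^ (a + b) = x `^ a * x `^ b.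
Proof. by move=> x0; rewrite powRD//; apply/implyP => _; rewrite gt_eqF. Qed.

Lemma powR_le_neg (x y a : R) : 0 < x -> x <= y -> 0 <= a ->
  y `^ (- a) <= x `^ (- a).
Proof.
move=> x0 xy a0; rewrite !powRN lef_pV2 ?posrE ?powR_gt0//; last first.
  exact: lt_le_trans xy.
by rewrite ge0_ler_powR ?nnegrE// ltW// (lt_le_trans x0).
Qed.

(** Makes the comparison with the majorant trivial on the axes. *)
Lemma two_powersM_axis (a b c d : R) (x y : TR) :
  x = 0 \/ y = 0 -> (two_powers a b x * two_powers c d y = +oo)%E.
Proof.
case=> ->; rewrite [X in (X * _)%E]/two_powers ?[X in (_ * X)%E]/two_powers eqxx.
  by rewrite gt0_mulye// two_powers_gt0.
by rewrite -/(two_powers a b x) gt0_muley// two_powers_gt0.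
Qed.

Section majorant.
Variables (p theta s v : R).
Hypotheses (p1 : 1 < p) (theta0 : 0 < theta) (v0 : 0 <= v).
Hypothesis vq : 2 * v * (Num.max p 2 - 1) <= Num.max p 2 - 2.
Let u : R := (1 - v) / Num.max p 2.
Hypotheses (vtheta : 2 * v < theta) (s0 : 0 < s) (su : s < 2 * u + 2 * v).

(** The decay bound to the power [2 / theta], times [|z|^(s / theta - 2)], is [|xi|^(-m) |z|^(-n)]
    up to a constant; [vtheta] gives [m < 1] and [su] gives [n + m > 2]. *)
Let m : R := 2 * v / theta.
Let n : R := 2 + (2 * u - s) / theta.
(** Half the order of the singularity of [|z|^(s / theta - 2)] at the origin, one share per
    coordinate; the minimum makes it [0] when there is no singularity. *)
Let e : R := 1 - Num.min 1 (s / (2 * theta)).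

Let m0 : 0 <= m. Proof. by rewrite divr_ge0 ?mulr_ge0// ltW. Qed.
Let m1 : m < 1. Proof. by rewrite ltr_pdivrMr// mul1r. Qed.
Let nm2 : 2 < n + m.
Proof.
have -> : n + m = 2 + (2 * u + 2 * v - s) / theta by rewrite /n /m; ring.
by rewrite ltrDl divr_gt0// subr_gt0.
Qed.
Let e0 : 0 <= e. Proof. by rewrite subr_ge0 ge_min lexx. Qed.
Let e1 : e < 1.
Proof. by rewrite ltrBlDr ltrDl lt_min ltr01 divr_gt0// mulr_gt0. Qed.
Let e2 : - (2 * e) <= s / theta - 2.
Proof.
have : Num.min 1 (s / (2 * theta)) <= s / (2 * theta) by rewrite ge_min lexx orbT.
have st : s / (2 * theta) = s / theta / 2 by field; rewrite gt_eqF.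
rewrite /e; set t := Num.min _ _; rewrite st; lra.
Qed.

Let H (a b : R) := @two_powers R a b.

(** In the unit disc the transform is at most [2] and [|z|^(-2e)] is shared equally by the
    coordinates. The second exponent [2] acts only beyond [1], where any value above [1] keeps the
    majorant integrable. *)
Lemma near_majorant (z : plane R) : z.1 != 0 -> z.2 != 0 -> enorm z <= 1 ->
  ((fa p z `^ (2 / theta) * enorm z `^ (s / theta - 2))%:E <=
   (2 `^ (2 / theta))%:E * (H e 2 z.1 * H e 2 z.2))%E.
Proof.
move=> z1 z2 nz.
have n1 : 0 < `|z.1| by rewrite normr_gt0.
have n2 : 0 < `|z.2| by rewrite normr_gt0.
have nz0 : 0 < enorm z by apply: lt_le_trans n1 (enorm_ge1 z).
rewrite /H /two_powers (negbTE z1) (negbTE z2).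
rewrite (le_trans (enorm_ge1 z) nz) (le_trans (enorm_ge2 z) nz).
rewrite /= -!EFinM lee_fin ler_pM ?powR_ge0//.
  rewrite ge0_ler_powR ?nnegrE ?fourier_abs_ge0 ?fourier_abs_le2//.
  by rewrite divr_ge0// ltW.
apply: (@le_trans _ _ (enorm z `^ (- e) * enorm z `^ (- e))).
  rewrite -gt0_powRD//.
  rewrite !powRE// ler_expR; have : ln (enorm z) <= 0 by exact: ln_le0.
  have := e2 => E2 L; rewrite -subr_ge0 -mulrBl mulr_le0//; lra.
by apply: ler_pM; rewrite ?powR_ge0// powR_le_neg ?enorm_ge1 ?enorm_ge2.
Qed.

(** Splitting [n = (n - m) / 2 + (n + m) / 2] gives both coordinates the exponent [(n + m) / 2 > 1]
    at infinity, while near the axes the first keeps [m < 1] and the second [0]. *)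
Lemma far_majorant (C : R) (z : plane R) : 0 < C ->
  fa p z * (enorm z `^ u * `|z.1| `^ v) <= C ->
  z.1 != 0 -> z.2 != 0 -> 1 <= enorm z ->
  ((fa p z `^ (2 / theta) * enorm z `^ (s / theta - 2))%:E <=
   (C `^ (2 / theta))%:E * (H m (m + (n - m) / 2) z.1 * H 0 ((n + m) / 2) z.2))%E.
Proof.
move=> C0 hC z1 z2 nz.
have n1 : 0 < `|z.1| by rewrite normr_gt0.
have n2 : 0 < `|z.2| by rewrite normr_gt0.
have nz0 : 0 < enorm z by exact: lt_le_trans nz.
have M1 := m1; have NM := nm2; have M0 := m0.
apply: (@le_trans _ _ (C `^ (2 / theta) * (`|z.1| `^ (- m) *
    enorm z `^ (- ((n - m) / 2)) * enorm z `^ (- ((n + m) / 2))))%:E).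
  rewrite lee_fin -mulrA -gt0_powRD//.
  have tt : 0 <= 2 / theta by rewrite divr_ge0// ltW.
  have : (fa p z * (enorm z `^ u * `|z.1| `^ v)) `^ (2 / theta) <= C `^ (2 / theta).
    by rewrite ge0_ler_powR ?nnegrE ?(ltW C0)// mulr_ge0 ?fourier_abs_ge0//
      mulr_ge0 ?powR_ge0.
  rewrite powRM ?fourier_abs_ge0 ?mulr_ge0 ?powR_ge0//.
  rewrite powRM ?powR_ge0// -!powRrM => HC.
  rewrite mulrC -ler_pdivlMl ?powR_gt0//.
  apply: le_trans (_ : C `^ (2 / theta) * (enorm z `^ (u * (2 / theta)) * `|z.1| `^
    (v * (2 / theta)))^-1 <= _).
    by rewrite -ler_pdivrMr ?invr_gt0 ?mulr_gt0 ?powR_gt0// invrK.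
  rewrite [leRHS]mulrCA ler_wpM2l ?powR_ge0//.
  rewrite invfM -!powRN mulrC !powRE// -!expRD ler_expR /n /m.
  by rewrite le_eqVlt; apply/orP; left; apply/eqP; field; rewrite gt_eqF.
rewrite EFinM; apply: lee_wpmul2l; first by rewrite lee_fin powR_ge0.
rewrite EFinM; apply: lee_pmul.
- by rewrite lee_fin mulr_ge0 ?powR_ge0.
- by rewrite lee_fin powR_ge0.
- rewrite /H /two_powers (negbTE z1); case: ifPn => [le|].
    rewrite lee_fin ler_piMr ?powR_ge0// (le_trans (powR_le_neg _ nz _))// ?powR1//.
    lra.
  rewrite -ltNge => lt; rewrite lee_fin opprD gt0_powRD//.
  by rewrite ler_wpM2l ?powR_ge0// powR_le_neg ?enorm_ge1//; lra.
- rewrite /H /two_powers (negbTE z2); case: ifPn => [le|].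
    rewrite lee_fin oppr0 powRr0 (le_trans (powR_le_neg _ nz _))// ?powR1//.
    lra.
  by rewrite -ltNge => lt; rewrite lee_fin powR_le_neg ?enorm_ge2//; lra.
Qed.

Lemma energy_lty : (energy s theta (@lift_lebesgue R p) < +oo)%E.
Proof.
have [C C0 hC] := fourier_decay p1 v0 vq.
have M1 := m1; have NM := nm2; have M0 := m0; have E1 := e1.
rewrite /energy gt_eqF//; apply: poweR_lty.
pose F1 z := ((2 `^ (2 / theta))%:E * (H e 2 z.1 * H e 2 z.2))%E.
pose F2 (z : plane R) := ((C `^ (2 / theta))%:E *
   (H m (m + (n - m) / 2) z.1 * H 0 ((n + m) / 2) z.2))%E.
have H0 a b x : (0 <= H a b x)%E by rewrite ltW// two_powers_gt0.
have mH a b c d : measurable_fun [set: plane R] (fun z => H a b z.1 * H c d z.2)%E.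
  apply: emeasurable_funM.
    exact: (measurableT_comp (measurable_two_powers a b) measurable_fst).
  exact: (measurableT_comp (measurable_two_powers c d) measurable_snd).
have mF1 : measurable_fun [set: plane R] F1 by exact: measurable_funeM.
have mF2 : measurable_fun [set: plane R] F2 by exact: measurable_funeM.
have F10 z : (0 <= F1 z)%E by rewrite !mule_ge0// lee_fin powR_ge0.
have F20 z : (0 <= F2 z)%E by rewrite !mule_ge0// lee_fin powR_ge0.
(* Adding the two majorants avoids splitting the plane into the disc and its complement. *)
apply: (@le_lt_trans _ _ (\int[(mu \x mu)%E]_(z in [set: plane R]) (F1 z + F2 z))%E).
  apply: ge0_le_integral => //.
  - by move=> z _; rewrite lee_fin mulr_ge0 ?powR_ge0.
  - apply/measurable_EFinP; apply: measurable_funM.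
      exact: (measurableT_comp (measurable_powR _) (measurable_fourier_abs p)).
    exact: (measurableT_comp (measurable_powR _) (@measurable_enorm R)).
  - exact: emeasurable_funD.
  - move=> z _.
    have [z1|z1] := eqVneq z.1 0.
      rewrite /F1 two_powersM_axis; last by left.
      by rewrite gt0_muley ?lte_fin ?powR_gt0// addye ?leey// gt_eqF// (lt_le_trans
        _ (F20 z)).
    have [z2|z2] := eqVneq z.2 0.
      rewrite /F1 two_powersM_axis; last by right.
      by rewrite gt0_muley ?lte_fin ?powR_gt0// addye ?leey// gt_eqF// (lt_le_trans
        _ (F20 z)).
    have [nz|/ltW nz] := leP (enorm z) 1.
      by apply: le_trans (near_majorant z1 z2 nz) _; rewrite leeDl.
    by apply: le_trans (far_majorant C0 (hC z) z1 z2 nz) _; rewrite leeDr.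
rewrite ge0_integralD// lte_add_pinfty//.
- rewrite ge0_integralZl ?lee_fin ?powR_ge0//; last first.
    by move=> z _; rewrite mule_ge0.
  rewrite lte_mul_pinfty// ?lee_fin ?powR_ge0//.
  rewrite integral_plane_prod//; [|exact: measurable_two_powers..].
  rewrite lte_mul_pinfty//.
  + by apply: integral_ge0 => x _.
  + rewrite ge0_fin_numE ?integral_two_powers//; [lra|].
    by apply: integral_ge0.
  + by apply: integral_two_powers => //; lra.
- rewrite ge0_integralZl ?lee_fin ?powR_ge0//; last first.
    by move=> z _; rewrite mule_ge0.
  rewrite lte_mul_pinfty// ?lee_fin ?powR_ge0//.
  rewrite integral_plane_prod//; [|exact: measurable_two_powers..].
  rewrite lte_mul_pinfty//.
  + by apply: integral_ge0 => x _.
  + rewrite ge0_fin_numE ?integral_two_powers//; [lra|].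
    by apply: integral_ge0.
  + by apply: integral_two_powers => //; lra.
Qed.

End majorant.

(** The square of the decay bound with [v = 0]; the supremum is finite at the critical exponent
    itself. *)
Lemma energy0_lty (p : R) : 1 < p ->
  (energy (2 / Num.max p 2)%R 0%R (@lift_lebesgue R p) < +oo)%E.
Proof.
move=> p1; have q2 : 2 <= Num.max p 2 by rewrite le_max lexx orbT.
have [|C C0 hC] := @fourier_decay _ p 0 p1 (lexx 0); first by lra.
rewrite /energy eqxx; apply: (@le_lt_trans _ _ (C ^+ 2)%:E); last exact: ltry.
apply: ge_ereal_sup => _ [z _ <-]; rewrite lee_fin.
have := hC z; rewrite powRr0 mulr1 subr0 mul1r => h.
rewrite (_ : enorm z `^ _ = (enorm z `^ (Num.max p 2)^-1) ^+ 2).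
  rewrite -exprMn ler_pXn2r ?nnegrE ?(ltW C0)// mulr_ge0 ?powR_ge0//.
  exact: fourier_abs_ge0.
by rewrite -powR_mulrn ?powR_ge0// -powRrM mulrC.
Qed.

End EnergyFinite.

(** * Fejer kernels *)

Section Fejer.
Context {R : realType}.
Notation mu := (@lebesgue_measure R).
Notation TR := (measurableTypeR R).

Definition triangle (N : R) (x : TR) : R := Num.max 0 (1 - `|x| / N).

Lemma triangle_ge0 N x : 0 <= triangle N x.
Proof. by rewrite le_max lexx. Qed.

Lemma triangle_le1 N x : 0 < N -> triangle N x <= 1.
Proof.
by move=> N0; rewrite ge_max ler01/= gerBl divr_ge0// ltW.
Qed.

Lemma triangle_out N x : 0 < N -> N < `|x| -> triangle N x = 0.
Proof.
by move=> N0 Nx; rewrite /triangle max_l// subr_le0 ler_pdivlMr// mul1r ltW.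
Qed.

Lemma measurable_triangle N : measurable_fun [set: TR] (triangle N).
Proof.
apply: measurable_maxr => //; apply: measurable_funB => //.
apply: measurable_funM => //; exact: normr_measurable.
Qed.

Let f (N c b x : R) : R := (1 - x / N) * (1 + cos (c + b * x)).

(** The trigonometric terms for [b != 0] come from one integration by parts of
    [(1 - x / N) * cos (c + b * x)]. *)
Let primitive (N c b x : R) : R := if b == 0
  then (x - x ^+ 2 / (2 * N)) * (1 + cos c)
  else x - x ^+ 2 / (2 * N) + (1 - x / N) * sin (c + b * x) / b
       - cos (c + b * x) / (N * b ^+ 2).

Let cf (N c b : R) : continuous (f N c b).
Proof.
move=> x; apply: cvgM.
  apply: cvgB; first exact: cvg_cst.
  by apply: cvgM; [exact: cvg_id|exact: cvg_cst].
apply: cvgD; first exact: cvg_cst.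
apply: (@continuous_comp _ _ _ (fun x => c + b * x) cos); last exact: continuous_cos.
apply: cvgD; first exact: cvg_cst.
by apply: cvgM; [exact: cvg_cst|exact: cvg_id].
Qed.

Let df (N c b x : R) : 0 < N -> is_derive x (1 : R) (primitive N c b) (f N c b x).
Proof.
move=> N0; rewrite /primitive /f; have [->|b0] := eqVneq b 0.
  apply: is_derive_eq.
  rewrite mul0r addr0 /GRing.scale/=. field; rewrite gt_eqF//.
have hd : is_derive x (1 : R) (fun x => c + b * x) b.
  by apply: is_derive_eq; rewrite /GRing.scale/=; ring.
have hs := @is_derive1_comp _ sin _ _ _ _ (is_derive_sin _) hd.
have hc := @is_derive1_comp _ cos _ _ _ _ (is_derive_cos _) hd.
rewrite /comp in hs hc.
apply: is_derive_eq.
by rewrite /GRing.scale/=; field; rewrite b0 gt_eqF.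
Qed.

Lemma half_triangle (N c b : R) : 0 < N ->
  (\int[mu]_(x in `]0%R, +oo[) (triangle N x * (1 + cos (c + b * x)))%:E =
   (primitive N c b N - primitive N c b 0)%:E)%E.
Proof.
move=> N0.
have mt : measurable_fun [set: TR] (fun x : TR => (triangle N x * (1 + cos (c + b *
  x)))%:E).
  apply/measurable_EFinP; apply: measurable_funM; first exact: measurable_triangle.
  apply: measurable_funD => //; apply: (@measurableT_comp _ _ _ _ _ _ cos).
    by apply: continuous_measurable_fun; exact: continuous_cos.
  by apply: measurable_funD => //; apply: measurable_funM.
have -> : `]0%R, +oo[%classic = `]0 : R, N]%classic `|` `]N, +oo[.
  by rewrite -!itv_bndbnd_setU// bnd_simp ?ltW.
rewrite ge0_integral_setU//; last 3 first.
- exact: measurable_funTS.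
- by move=> x _; rewrite lee_fin mulr_ge0 ?triangle_ge0// -lerBlDl sub0r cos_geN1.
- rewrite disj_set2E; apply/eqP; rewrite -subset0 => x/=.
  by rewrite !in_itv/= andbT => -[/andP[_ x1]]; rewrite ltNge x1.
rewrite [X in (_ + X)%E]integral0_eq ?adde0; last first.
  move=> x /=; rewrite in_itv/= andbT => Nx.
  by rewrite triangle_out ?mul0r// (lt_le_trans Nx)// ler_norm.
rewrite integral_itv_obnd_cbnd; last exact: measurable_funTS.
transitivity (\int[mu]_(x in `[0%R, N]) (f N c b x)%:E)%E.
  apply: eq_integral => x; rewrite inE/= in_itv/= => /andP[x0 xN].
  rewrite /triangle /f ger0_norm// max_r// subr_ge0 ler_pdivrMr//.
  by rewrite mul1r.
rewrite -[LHS]fineK; last first.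
  apply: integrable_fin_num => //; apply: continuous_itv_integrable => x _.
  exact: cf.
congr EFin; apply: Rintegral_derive; first exact: ltW.
- by move=> x _; exact: cf.
- by move=> x _; exact: df.
Qed.

(* The Fourier transform of [triangle N] at [b / (2 pi)]. *)
Definition fejer (N b : R) : R :=
  if b == 0 then N else 2 * (1 - cos (b * N)) / (N * b ^+ 2).

Lemma fejer_ge0 N b : 0 < N -> 0 <= fejer N b.
Proof.
move=> N0; rewrite /fejer; case: ifP => [_|_]; first exact: ltW.
by apply: divr_ge0; apply: mulr_ge0; rewrite ?subr_ge0 ?cos_le1 ?sqr_ge0 ?(ltW N0).
Qed.

(** The half-lines carry the phases [c + b x] and [c - b x]; their sine terms cancel and leave the
    factor [cos c]. Special values of [c] then yield the bounds on [fejer] without its formula. *)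
Lemma integral_triangle (N c b : R) : 0 < N ->
  (\int[mu]_x (triangle N x * (1 + cos (c + b * x)))%:E =
   (N + cos c * fejer N b)%:E)%E.
Proof.
move=> N0; rewrite ge0_integral_fold; last 2 first.
- apply/measurable_EFinP; apply: measurable_funM; first exact: measurable_triangle.
  apply: measurable_funD => //; apply: (@measurableT_comp _ _ _ _ _ _ cos).
    by apply: continuous_measurable_fun; exact: continuous_cos.
  by apply: measurable_funD => //; apply: measurable_funM.
- by move=> x; rewrite lee_fin mulr_ge0 ?triangle_ge0// -lerBlDl sub0r cos_geN1.
rewrite half_triangle//.
under eq_integral do rewrite /triangle normrN mulrN -mulNr -/(triangle _ _).
rewrite half_triangle// -EFinD; congr EFin.
rewrite /primitive /fejer oppr_eq0; have [_|b0] := eqVneq b 0.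
  by field; rewrite gt_eqF.
rewrite !mulr0 !addr0 cosD (mulNr b N) cosD cosN sinN.
by field; rewrite b0 gt_eqF.
Qed.

(** At [c = pi] the nonnegative integral of [integral_triangle] is [N - fejer N b]. *)
Lemma fejer_le N b : 0 < N -> fejer N b <= N.
Proof.
move=> N0; have := @integral_triangle N pi b N0; rewrite cospi mulN1r => E.
rewrite -subr_ge0 -lee_fin -E; apply: integral_ge0 => x _.
by rewrite lee_fin mulr_ge0 ?triangle_ge0// -lerBlDl sub0r cos_geN1.
Qed.

Lemma integral_triangle1 N : 0 < N -> (\int[mu]_x (triangle N x)%:E = N%:E)%E.
Proof.
move=> N0; have := @integral_triangle N (pi / 2) 0 N0.
rewrite cos_pihalf mul0r addr0 => <-; apply: eq_integral => x _.
by rewrite mul0r addr0 cos_pihalf addr0 mulr1.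
Qed.

(** The doubled angle stays within [pi / 2], so [2 cos^2 t - 1 >= 0]. *)
Lemma cos_ge_half (t : R) : `|t| <= 2^-1 -> 2^-1 <= cos t.
Proof.
rewrite ler_norml => /andP[t1 t2].
have ph := pihalf_ge1 R.
have c0 : 0 <= cos t by apply: cos_ge0_pihalf; apply/andP; split; lra.
have : 0 <= cos (t *+ 2) by apply: cos_ge0_pihalf; rewrite (mulr2n t); apply/andP;
  split; lra.
by rewrite cos_mulr2n; nra.
Qed.

(** On the support of the triangle [cos (b x) >= 1/2], so at [c = 0] the integral [N + fejer N b] is
    at least [3 N / 2]. *)
Lemma fejer_ge_half N b : 0 < N -> `|b| * N <= 2^-1 -> N / 2 <= fejer N b.
Proof.
move=> N0 bN; have E := @integral_triangle N 0 b N0.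
have : ((3 / 2 * N)%:E <= (N + cos 0 * fejer N b)%:E)%E.
  have mt := @measurable_triangle N.
  rewrite -E (_ : (3 / 2 * N)%:E =
      \int[mu]_x ((3 / 2)%:E * (triangle N x)%:E))%E; last first.
    rewrite ge0_integralZl ?integral_triangle1 ?lee_fin//.
      by apply/measurable_EFinP.
    by move=> x _; rewrite lee_fin triangle_ge0.
  apply: ge0_le_integral => //.
  - by move=> x _; rewrite mule_ge0// lee_fin ?triangle_ge0//; lra.
  - by apply: measurable_funeM; exact/measurable_EFinP.
  - apply/measurable_EFinP; apply: measurable_funM => //.
    apply: measurable_funD => //; apply: (@measurableT_comp _ _ _ _ _ _ cos).
      by apply: continuous_measurable_fun; exact: continuous_cos.
    by apply: measurable_funD => //; apply: measurable_funM.
  - move=> x _; rewrite -EFinM lee_fin mulrC.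
    have [le|lt] := leP `|x| N; last by rewrite triangle_out// !mul0r.
    rewrite ler_wpM2l ?triangle_ge0// add0r.
    have : 2^-1 <= cos (b * x).
      apply: cos_ge_half; apply: le_trans bN.
      by rewrite normrM ler_wpM2l.
    lra.
by rewrite lee_fin cos0 mul1r; lra.
Qed.

End Fejer.

(** * Averages of the squared Fourier transform over boxes *)

Section Weighted.
Context {R : realType}.
Notation mu := (@lebesgue_measure R).
Notation mu01 := (@lebesgue01 R).
Notation TR := (measurableTypeR R).
Notation fa p := (fourier_abs (@lift_lebesgue R p)).

Lemma onepcos_ge0 (t : R) : 0 <= 1 + cos t.
Proof. by rewrite -lerBlDl sub0r cos_geN1. Qed.

Lemma measurable_onepcos d (T : measurableType d) (f : T -> R) :
  measurable_fun [set: T] f -> measurable_fun [set: T] (fun x => 1 + cos (f x)).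
Proof.
move=> mf; apply: measurable_funD => //;
  apply: (@measurableT_comp _ _ _ _ _ _ cos) => //.
by apply: continuous_measurable_fun; exact: continuous_cos.
Qed.

(** The inner integral [N + k cos (a x)] is written as [(N - k) + k (1 + cos (a x))], with both
    coefficients nonnegative, so that the outer integral is again an instance of
    [integral_triangle]. *)
Lemma fejer_plane (A N a b : R) : 0 < A -> 0 < N ->
  (\int[(mu \x mu)%E]_(z in [set: plane R])
     (triangle A z.1 * triangle N z.2 * (1 + cos (a * z.1 + b * z.2)))%:E =
   (A * N + fejer A a * fejer N b)%:E)%E.
Proof.
move=> A0 N0.
have mtA := @measurable_triangle R A; have mtN := @measurable_triangle R N.
rewrite fubini_tonelli1//=; last 2 first.
- apply/measurable_EFinP; apply: measurable_funM.
    apply: measurable_funM.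
      exact: (measurableT_comp mtA measurable_fst).
    exact: (measurableT_comp mtN measurable_snd).
  by apply: measurable_onepcos; apply: measurable_funD; apply: measurable_funM.
- by move=> z; rewrite lee_fin !mulr_ge0 ?triangle_ge0 ?onepcos_ge0.
rewrite /fubini_F/=.
set k := fejer N b.
have k0 : 0 <= k by exact: fejer_ge0.
have kN : 0 <= N - k by rewrite subr_ge0 fejer_le.
transitivity (\int[mu]_x ((N - k)%:E * (triangle A x)%:E +
   k%:E * (triangle A x * (1 + cos (0 + a * x)))%:E))%E.
  apply: eq_integral => x _.
  transitivity (\int[mu]_y ((triangle A x)%:E * (triangle N y * (1 + cos (a * x + b
    * y)))%:E))%E.
    by apply: eq_integral => y _; rewrite -EFinM mulrA.
  rewrite ge0_integralZl//.
  - rewrite integral_triangle// -!EFinM -EFinD; congr EFin; rewrite add0r -/k; ring.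
  - apply/measurable_EFinP; apply: measurable_funM => //.
    by apply: measurable_onepcos; apply: measurable_funD => //; apply: measurable_funM.
  - by move=> y _; rewrite lee_fin mulr_ge0 ?triangle_ge0 ?onepcos_ge0.
  - by rewrite lee_fin triangle_ge0.
have m1 : measurable_fun [set: TR] (fun x : TR => (triangle A x)%:E).
  exact/measurable_EFinP.
have m2 : measurable_fun [set: TR] (fun x : TR => (triangle A x * (1 + cos (0 + a *
  x)))%:E).
  apply/measurable_EFinP; apply: measurable_funM => //.
  by apply: measurable_onepcos; apply: measurable_funD => //; apply: measurable_funM.
have p1 x : (0 <= (triangle A x)%:E)%E by rewrite lee_fin triangle_ge0.
have p2 x : (0 <= (triangle A x * (1 + cos (0 + a * x)))%:E)%E.
  by rewrite lee_fin mulr_ge0 ?triangle_ge0 ?onepcos_ge0.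
rewrite ge0_integralD//; last 4 first.
- by move=> x _; rewrite mule_ge0// lee_fin.
- exact: measurable_funeM.
- by move=> x _; rewrite mule_ge0// lee_fin.
- exact: measurable_funeM.
rewrite (ge0_integralZl _ _ m1)// (ge0_integralZl _ _ m2)//.
rewrite integral_triangle1// integral_triangle// cos0 mul1r -!EFinM -EFinD.
by congr EFin; ring.
Qed.

Lemma oscint_shift (c k h p : R) :
  oscint c k h p = cos c * oscint 0 k h p + sin c * oscint (pi / 2) k h p.
Proof.
have ic c' := integrable_cos_phase c' k h p 0 1.
have iZ c' r : mu.-integrable `[0, 1] (EFin \o (fun x => r * cos (phase c' k h p x))).
  rewrite (_ : _ \o _ = (fun x => r%:E * (EFin \o (cos \o phase c' k h p)) x)%E)//.
  exact: integrableZl.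
transitivity (\int[mu]_(x in `[0, 1])
  (cos c * cos (phase 0 k h p x) + sin c * cos (phase (pi / 2) k h p x))).
  apply: eq_Rintegral => x _.
  have -> : phase c k h p x = c + phase 0 k h p x by rewrite /phase; ring.
  have -> : phase (pi / 2) k h p x = phase 0 k h p x + pi / 2 by rewrite /phase; ring.
  by rewrite cosD cosDpihalf mulrN.
rewrite (RintegralD _ (iZ 0 (cos c)) (iZ (pi / 2) (sin c)))//.
by rewrite (RintegralZl _ _ (ic 0))// (RintegralZl _ _ (ic (pi / 2))).
Qed.

(** The squared modulus of an integral as a double integral: the phase at [x] acts as a shift [c] in
    the integral over [y], and [oscint_shift] resolves it into [C] and [S]. *)
Lemma double_integral_cos (k h p : R) :
  (\int[mu01]_x \int[mu01]_y (1 + cos (k * (x - y) + h * (x `^ p - y `^ p)))%:E =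
   (1 + (oscint 0 k h p ^+ 2 + oscint (pi / 2) k h p ^+ 2))%:E)%E.
Proof.
set C := oscint 0 k h p; set S := oscint (pi / 2) k h p.
transitivity (\int[mu01]_x (1%:E + (C%:E * (EFin \o (cos \o phase 0 k h p)) x +
    S%:E * (EFin \o (cos \o phase (pi / 2) k h p)) x)))%E.
  apply: eq_integral => x _.
  transitivity (\int[mu01]_y (1 + cos (phase (- phase 0 k h p x) k h p y))%:E)%E.
    apply: eq_integral => y _; congr (_%:E); congr (1 + _).
    by rewrite -[LHS]cosN; congr cos; rewrite /phase; ring.
  rewrite integral_onepcos_phase oscint_shift cosN sinN -/C -/S /=.
  have -> : phase (pi / 2) k h p x = phase 0 k h p x + pi / 2 by rewrite /phase; ring.
  by rewrite cosDpihalf -!EFinM -!EFinD; congr EFin; ring.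
have i1 : mu01.-integrable [set: TR] (EFin \o cst (1 : R)).
  apply: measurable_bounded_integrable => //; first exact: lebesgue01_lty.
  by exists 1; split=> // M M1 x _ /=; rewrite normr1 ltW.
have ic c := integrable_lebesgue01_cos_phase c k h p.
have icC : mu01.-integrable [set: TR] (fun x => C%:E * (EFin \o (cos \o phase 0 k h
  p)) x)%E.
  exact: integrableZl.
have icS : mu01.-integrable [set: TR] (fun x => S%:E * (EFin \o (cos \o phase (pi /
  2) k h p)) x)%E.
  exact: integrableZl.
rewrite (integralD measurableT i1 (integrableD measurableT icC icS)).
rewrite (integralD measurableT icC icS).
rewrite (integralZl measurableT (ic _)) (integralZl measurableT (ic _)).
rewrite !integral_lebesgue01_cos_phase -/C -/S.
rewrite [X in (X + _)%E](_ : _ = 1%E).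
  by rewrite -!EFinM -!EFinD !expr2.
rewrite [LHS](_ : _ = \int[mu01]_x cst 1%E x)%E// integral_cst// mul1e.
exact: lebesgue01T.
Qed.

(** The third variable passes the product one coordinate at a time, first [m2], then [m1]; [G'] is
    [G] with its variables reordered for the second exchange. *)
Lemma fubini_tonelli_product d1 d2 d3 (T1 : measurableType d1)
    (T2 : measurableType d2) (T3 : measurableType d3)
    (m1 : {sigma_finite_measure set T1 -> \bar R})
    (m2 : {sigma_finite_measure set T2 -> \bar R})
    (m3 : {sigma_finite_measure set T3 -> \bar R})
    (G : (T1 * T2) * T3 -> \bar R) :
  measurable_fun [set: (T1 * T2) * T3] G -> (forall q, 0 <= G q)%E ->
  (\int[(m1 \x m2)%E]_z \int[m3]_w G (z, w) =
   \int[m3]_w \int[(m1 \x m2)%E]_z G (z, w))%E.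
Proof.
move=> mG G0.
pose G' (q : (T1 * T3) * T2) := G ((q.1.1, q.2), q.1.2).
have mG' : measurable_fun [set: (T1 * T3) * T2] G'.
  apply: (measurableT_comp mG); apply: measurable_fun_pair.
    apply: measurable_fun_pair => //.
    exact: (measurableT_comp measurable_fst measurable_fst).
  exact: (measurableT_comp measurable_snd measurable_fst).
have G'0 q : (0 <= G' q)%E by exact: G0.
have m12 := measurable_fun_fubini_tonelli_F (m2 := m3) G mG G0.
have m13 := measurable_fun_fubini_tonelli_F (m2 := m2) G' mG' G'0.
rewrite (fubini_tonelli1 (m1 := m1) (m2 := m2) _ m12); last first.
  by move=> z; apply: integral_ge0.
transitivity (\int[m1]_x \int[m3]_w \int[m2]_y G' ((x, w), y))%E.
  apply: eq_integral => x _; rewrite /fubini_F.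
  apply: (fubini_tonelli (m1 := m2) (m2 := m3) (fun q => G ((x, q.1), q.2))).
    apply: (measurableT_comp mG); apply: measurable_fun_pair => //.
    exact: measurable_fun_pair.
  by move=> q; exact: G0.
rewrite (fubini_tonelli (m1 := m1) (m2 := m3) _ m13); last first.
  by move=> q; apply: integral_ge0.
apply: eq_integral => w _.
rewrite (fubini_tonelli1 (m1 := m1) (m2 := m2) (fun z => G (z, w)))//.
exact: (measurableT_comp mG (pair2_measurable w)).
Qed.

(* The factor [1 + _] keeps every integrand nonnegative, so that Tonelli applies. *)
Lemma weighted_energyE (p A N : R) : 0 < A -> 0 < N ->
  (\int[(mu \x mu)%E]_(z in [set: plane R])
     (triangle A z.1 * triangle N z.2 * (1 + fa p z ^+ 2))%:E =
   \int[mu01]_x \int[mu01]_y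
     (A * N + fejer A (2 * pi * (x - y)) * fejer N (2 * pi * (x `^ p - y `^ p)))%:E)%E.
Proof.
move=> A0 N0.
pose G (q : (plane R * TR) * TR) : \bar R :=
  (triangle A q.1.1.1 * triangle N q.1.1.2 *
   (1 + cos (2 * pi * (q.1.2 - q.2) * q.1.1.1 +
             2 * pi * (q.1.2 `^ p - q.2 `^ p) * q.1.1.2)))%:E.
have mtA := @measurable_triangle R A; have mtN := @measurable_triangle R N.
have mz : measurable_fun [set: (plane R * TR) * TR] (fun q => q.1.1).
  exact: (measurableT_comp measurable_fst measurable_fst).
have mx : measurable_fun [set: (plane R * TR) * TR] (fun q => q.1.2).
  exact: (measurableT_comp measurable_snd measurable_fst).
have my : measurable_fun [set: (plane R * TR) * TR] (fun q => q.2).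
  exact: measurable_snd.
have mz1 : measurable_fun [set: (plane R * TR) * TR] (fun q => q.1.1.1).
  exact: (measurableT_comp measurable_fst mz).
have mz2 : measurable_fun [set: (plane R * TR) * TR] (fun q => q.1.1.2).
  exact: (measurableT_comp measurable_snd mz).
have mG : measurable_fun [set: (plane R * TR) * TR] G.
  apply/measurable_EFinP; apply: measurable_funM.
    apply: measurable_funM.
      exact: (measurableT_comp mtA mz1).
    exact: (measurableT_comp mtN mz2).
  apply: measurable_onepcos; apply: measurable_funD; apply: measurable_funM => //;
    apply: measurable_funM => //; apply: measurable_funB => //.
    exact: (measurableT_comp (measurable_powR p) mx).
  exact: (measurableT_comp (measurable_powR p) my).
have G0 q : (0 <= G q)%E.
  by rewrite lee_fin !mulr_ge0 ?triangle_ge0 ?onepcos_ge0.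
have mGF := measurable_fun_fubini_tonelli_F (m2 := mu01) G mG G0.
(* The integral in [z] is moved inside past [x], then past [y], where [fejer_plane] evaluates it. *)
transitivity (\int[(mu \x mu)%E]_(z in [set: plane R])
    \int[mu01]_x \int[mu01]_y G ((z, x), y))%E.
  apply: eq_integral => z _.
  rewrite fourier_absE sqr_sqrtr ?addr_ge0 ?sqr_ge0//.
  rewrite EFinM -double_integral_cos.
  have mc : measurable_fun [set: plane R] (fun w : plane R =>
      (1 + cos (2 * pi * z.1 * (w.1 - w.2) + 2 * pi * z.2 * (w.1 `^ p - w.2 `^ p)))%:E).
    apply/measurable_EFinP; apply: measurable_onepcos; apply: measurable_funD;
      apply: measurable_funM => //.
      exact: measurable_funB.
    apply: measurable_funB.
      exact: (measurableT_comp (measurable_powR p) measurable_fst).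
    exact: (measurableT_comp (measurable_powR p) measurable_snd).
  have t0 : (0 <= (triangle A z.1 * triangle N z.2)%:E)%E.
    by rewrite lee_fin mulr_ge0 ?triangle_ge0.
  rewrite -ge0_integralZl//; last 2 first.
  - exact: (measurable_fun_fubini_tonelli_F (m2 := mu01) _ mc (fun w => (_ : 0 <=
    (_)%:E)%E)).
  - by move=> x _; apply: integral_ge0 => y _; rewrite lee_fin onepcos_ge0.
  apply: eq_integral => x _; rewrite -ge0_integralZl//; last first.
    exact: (measurableT_comp mc (measurable_pair1 x)).
  apply: eq_integral => y _; rewrite -EFinM; congr (_ * (1 + cos _))%:E.
  by rewrite /=; ring.
transitivity (\int[mu01]_x \int[(mu \x mu)%E]_(z in [set: plane R])
    \int[mu01]_y G ((z, x), y))%E.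
  apply: (fubini_tonelli_product mu mu mu01 mGF) => q.
  exact: integral_ge0.
apply: eq_integral => x _.
transitivity (\int[mu01]_y \int[(mu \x mu)%E]_(z in [set: plane R])
    G ((z, x), y))%E.
  apply: (fubini_tonelli_product (G := fun q => G ((q.1, x), q.2)) mu mu mu01) => //.
  apply: (measurableT_comp mG); apply: measurable_fun_pair => //.
  exact: measurable_fun_pair.
by apply: eq_integral => y _;
  exact: (@fejer_plane A N (2 * pi * (x - y)) (2 * pi * (x `^ p - y `^ p)) A0 N0).
Qed.

End Weighted.

(** * Lower bound for the box averages *)

Section WeightedLower.
Context {R : realType}.
Notation mu := (@lebesgue_measure R).
Notation mu01 := (@lebesgue01 R).
Notation TR := (measurableTypeR R).
Notation fa p := (fourier_abs (@lift_lebesgue R p)).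

Lemma powR_increment (p D x y : R) : 1 < p -> 0 <= x -> x <= y -> y <= D ->
  y `^ p - x `^ p <= p * D `^ (p - 1) * (y - x).
Proof.
move=> p1 x0; rewrite le_eqVlt => /predU1P[<-|xy] yD; first by rewrite !subrr mulr0.
have y0 : 0 < y by exact: le_lt_trans xy.
have Dm t : 0 <= t -> t <= D -> t `^ (p - 1) <= D `^ (p - 1).
  by move=> t0 tD; rewrite ge0_ler_powR ?nnegrE//; lra.
have [x00|xn0] := eqVneq x 0.
  rewrite x00 powR0 ?subr0; last by rewrite gt_eqF//; lra.
  rewrite -(mulr_powRB1 (ltW y0)); last lra.
  rewrite -mulrA (mulrC _ y) mulrCA ler_wpM2l ?(ltW y0)//.
  apply: le_trans (Dm _ (ltW y0) yD) _; rewrite ler_peMl ?powR_ge0//.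
  lra.
have xp : 0 < x by rewrite lt_neqAle eq_sym xn0.
have [||z] := @MVT _ (fun t : R => t `^ p) (fun t => p * t `^ (p - 1)) x y xy.
- by move=> z; rewrite in_itv/= => /andP[xz _]; apply: is_derive1_powR;
  exact: lt_trans xz.
- apply: continuous_in_subspaceT => z /set_mem/=; rewrite in_itv/= => /andP[xz _].
  by apply: continuous_powR; exact: lt_le_trans xz.
rewrite in_itv/= => /andP[xz zy] ->.
rewrite ler_wpM2r ?subr_ge0 ?(ltW xy)// ler_wpM2l//; first lra.
by apply: Dm; [rewrite ltW// (lt_trans xp)|rewrite (le_trans (ltW zy))].
Qed.

Lemma measurable_fejer N : measurable_fun [set: TR] (fejer N).
Proof.
apply: measurable_fun_ifT; [exact: measurable_fun_eqr|exact: measurable_cst|].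
apply: measurable_funM.
  apply: measurable_funM => //; apply: measurable_funB => //.
  apply: (@measurableT_comp _ _ _ _ _ _ cos).
    by apply: continuous_measurable_fun; exact: continuous_cos.
  exact: measurable_funM.
(* The form with [powR] makes measurability a matter of composition; at [x = 0] both sides are
   [0]. *)
have -> : (fun x : R => (N * x ^+ 2)^-1) = (fun x : R => N^-1 * (`|x| `^ (- 2))).
  apply/funext => x; rewrite invfM powRN powR_mulrn//. by rewrite real_normK ?num_real.
apply: measurable_funM => //.
exact: (measurableT_comp (measurable_powR _) (@normr_measurable R setT)).
Qed.

(** On the strip [0 <= x <= L], [x <= y <= x + r] both kernels are at least half of their maxima [A]
    and [N]. The strip has area [L r]; elsewhere nonnegativity is enough. *)
Lemma weighted_energy_ge (p A N L r : R) : 1 < p -> 0 < A -> 0 < N ->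
  0 < L -> 0 < r -> L + r <= 1 ->
  2 * pi * r * A <= 2^-1 -> 2 * pi * (p * (L + r) `^ (p - 1) * r) * N <= 2^-1 ->
  ((A * N * (1 + L * r / 4))%:E <=
   \int[(mu \x mu)%E]_(z in [set: plane R])
     (triangle A z.1 * triangle N z.2 * (1 + fa p z ^+ 2))%:E)%E.
Proof.
move=> p1 A0 N0 L0 r0 Lr rA rN; rewrite weighted_energyE//.
have AN0 : 0 <= A * N by rewrite mulr_ge0// ltW.
pose K (x y : R) := fejer A (2 * pi * (x - y)) * fejer N (2 * pi * (x `^ p - y `^ p)).
have K0 x y : 0 <= K x y by rewrite mulr_ge0// fejer_ge0.
have KE x y : 0 <= x <= L -> x <= y <= x + r -> A * N / 4 <= K x y.
  move=> /andP[x0 xL] /andP[xy yr].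
  rewrite (_ : A * N / 4 = (A / 2) * (N / 2)); last by field.
  have pi0 : 0 < 2 * pi :> R by rewrite mulr_gt0 ?pi_gt0.
  apply: ler_pM; rewrite ?divr_ge0 ?(ltW A0) ?(ltW N0)//.
    apply: fejer_ge_half => //; apply: le_trans rA.
    rewrite normrM (ger0_norm (ltW pi0)) ler_wpM2r ?(ltW A0)// ler_wpM2l ?(ltW pi0)//.
    by rewrite distrC ger0_norm ?subr_ge0//; lra.
  apply: fejer_ge_half => //; apply: le_trans rN.
  rewrite normrM (ger0_norm (ltW pi0)) ler_wpM2r ?(ltW N0)// ler_wpM2l ?(ltW pi0)//.
  rewrite distrC ger0_norm; last first.
    by rewrite subr_ge0 ge0_ler_powR ?nnegrE//; lra.
  apply: le_trans (@powR_increment p (L + r) x y p1 x0 xy _) _; first lra.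
  by rewrite ler_wpM2l ?mulr_ge0 ?powR_ge0//; lra.
have mK : measurable_fun [set: TR * TR] (fun w : TR * TR => (A * N + K w.1 w.2)%:E).
  apply/measurable_EFinP; apply: measurable_funD => //.
  apply: measurable_funM.
    apply: (measurableT_comp (measurable_fejer A)).
    by apply: measurable_funM => //; exact: measurable_funB.
  apply: (measurableT_comp (measurable_fejer N)).
  apply: measurable_funM => //; apply: measurable_funB.
    exact: (measurableT_comp (measurable_powR p) measurable_fst).
  exact: (measurableT_comp (measurable_powR p) measurable_snd).
have mu01itv (a b : R) : 0 <= a -> a <= b -> b <= 1 -> mu01 (`[a, b]%classic : set
  TR) = (b - a)%:E.
  move=> a0 ab b1; rewrite /= /mfrestr /mrestr setIidl; last first.
    by move=> t /=; rewrite !in_itv/= => /andP[at_ tb]; apply/andP; split; lra.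
  rewrite lebesgue_measure_itv/= lte_fin.
  by case: ltP => // ba; rewrite (_ : b = a) ?subrr//; apply/eqP; rewrite eq_le ba.
have step (a b c d : R) : 0 <= a -> a <= b -> b <= 1 -> 0 <= c -> 0 <= d ->
    (\int[mu01]_y (c + d * \1_(`[a, b]%classic : set TR) y)%:E = (c + d * (b -
      a))%:E)%E.
  move=> a0 ab b1 c0 d0.
  have mi : measurable_fun [set: TR] (fun y : TR => (\1_(`[a, b]%classic : set TR)
    y)%:E : \bar R).
    by apply/measurable_EFinP; apply: measurable_indic; exact: measurable_itv.
  under eq_integral do rewrite EFinD EFinM.
  rewrite ge0_integralD//; last 2 first.
  - by move=> y _; rewrite mule_ge0// lee_fin.
  - exact: measurable_funeM.
  rewrite ge0_integralZl//.
  rewrite integral_indic// [X in (_ + _ * X)%E](_ : _ = (b - a)%:E); last first.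
    by rewrite setIT; exact: mu01itv.
  rewrite [X in (X + _)%E](_ : _ = c%:E) -?EFinM//.
  rewrite [LHS](_ : _ = \int[mu01]_x cst c%:E x)%E// integral_cst//.
  by rewrite [X in (_ * X)%E](_ : _ = 1%E) ?mule1//; exact: lebesgue01T.
have mc (a b c d : R) : measurable_fun [set: TR]
    (fun y => (c + d * \1_(`[a, b]%classic : set TR) y)%:E).
  apply/measurable_EFinP; apply: measurable_funD => //; exact: measurable_funM.
have inner x : ((A * N + A * N / 4 * r * \1_(`[0, L]%classic : set TR) x)%:E <=
     \int[mu01]_y (A * N + K x y)%:E)%E.
  have mKx : measurable_fun [set: TR] (fun y : TR => (A * N + K x y)%:E).
    exact: (measurableT_comp mK (pair1_measurable x)).
  have [xL|xL] := boolP (x \in `[0, L]).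
    have /andP[x0 x1] : 0 <= x <= L by move: xL; rewrite in_itv.
    rewrite indicE mem_set//= mulr1.
    have xr : x <= x + r by lra.
    have xr1 : x + r <= 1 by lra.
    have d0 : 0 <= A * N / 4 by rewrite divr_ge0.
    have := step x (x + r) (A * N) (A * N / 4) x0 xr xr1 AN0 d0.
    rewrite (_ : x + r - x = r); last by ring.
    move=> <-; apply: ge0_le_integral => //.
    - by move=> y _; rewrite lee_fin addr_ge0// mulr_ge0.
    - move=> y _; rewrite lee_fin lerD2l indicE.
      have [yx|yx] := boolP (y \in _); last by rewrite mulr0.
      rewrite mulr1 KE ?x0 ?x1//.
      by move: yx; rewrite inE/= in_itv.
  rewrite indicE memNset /= ?mulr0 ?addr0; last exact/negP.
  (* A step of height [0] on the degenerate interval [[0, 0]]: the integral of the constant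
     [A * N]. *)
  have := step 0 0 (A * N) 0 (lexx 0) (lexx 0) ler01 AN0 (lexx 0).
  rewrite mul0r addr0 => <-; apply: ge0_le_integral => //.
  - by move=> y _; rewrite lee_fin mul0r addr0.
  - by move=> y _; rewrite lee_fin mul0r addr0 lerDl.
have := step 0 L (A * N) (A * N / 4 * r) (lexx 0) (ltW L0) _ AN0 _.
rewrite subr0 (_ : A * N + A * N / 4 * r * L = A * N * (1 + L * r / 4)); last by field.
move=> <-; [|lra|by rewrite mulr_ge0 ?divr_ge0// ltW].
apply: ge0_le_integral => //.
- by move=> x _; rewrite lee_fin addr_ge0// !mulr_ge0// ltW.
- apply: (measurable_fun_fubini_tonelli_F (m2 := mu01) _ mK) => w.
  by rewrite lee_fin addr_ge0.
Qed.

End WeightedLower.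

(** * Infinite energies *)

Section BoxUpper.
Context {R : realType}.
Notation mu := (@lebesgue_measure R).
Notation TR := (measurableTypeR R).
Notation fa p := (fourier_abs (@lift_lebesgue R p)).

Lemma trunc_power_in (N a x : R) : `|x| <= N ->
  trunc_power N a x = Num.max 1 `|x| `^ (- a).
Proof. by rewrite /trunc_power => ->. Qed.

(** Both [max 1 |z.1|] and [max 1 |z.2|] are at most [|z|] here, so the decay can be distributed
    freely over the coordinates. *)
Lemma enorm_powN_le (A N a1 a2 : R) (z : plane R) : 0 <= a1 -> 0 <= a2 ->
  1 <= enorm z -> `|z.1| <= A -> `|z.2| <= N ->
  enorm z `^ (- (a1 + a2)) <= trunc_power A a1 z.1 * trunc_power N a2 z.2.
Proof.
move=> a10 a20 z1 zA zN; have z0 : 0 < enorm z by exact: lt_le_trans z1.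
rewrite !trunc_power_in// opprD gt0_powRD//.
apply: ler_pM; rewrite ?powR_ge0// powR_le_neg// ?lt_max ?ltr01// ge_max z1/=.
  exact: enorm_ge1.
exact: enorm_ge2.
Qed.

(* Replaces Hoelder's inequality: [t] may depend on the point. *)
Lemma threshold_split (X t q : R) : 0 <= X -> 0 < t -> 1 <= q ->
  X <= t + t `^ (1 - q) * X `^ q.
Proof.
move=> X0 t0 q1; have [Xt|tX] := leP X t.
  by apply: le_trans Xt _; rewrite lerDl mulr_ge0 ?powR_ge0.
have Xp : 0 < X by exact: lt_trans tX.
apply: (@le_trans _ _ (t `^ (1 - q) * X `^ q)); last by rewrite lerDr ltW.
rewrite !powRE// -expRD -{1}(lnK Xp) ler_expR.
have : ln t < ln X by rewrite ltr_ln.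
by move=> h; have : 0 <= (q - 1) * (ln X - ln t) by [rewrite mulr_ge0//; lra]; lra.
Qed.

Definition energy_integrand (p theta s : R) (z : plane R) : R :=
  fa p z `^ (2 / theta) * enorm z `^ (s / theta - 2).

(** [threshold_split] with [t = tau |z|^(-(a1 + a2))] and [q = 1 / theta] handles [|z| > 1]; the
    first summand covers the unit disc, where the squared transform is at most [4]. *)
Lemma fourier_sq_le_pos (p theta s A N a1 a2 tau : R) (z : plane R) :
  0 < theta <= 1 -> 0 <= a1 -> 0 <= a2 -> a1 + a2 <= s -> a1 + a2 <= 2 ->
  0 < tau -> 1 <= A <= N -> `|z.1| <= A -> `|z.2| <= N ->
  fa p z ^+ 2 <= 4 * (trunc_power 1 0 z.1 * trunc_power 1 0 z.2) +
    tau * (trunc_power A a1 z.1 * trunc_power N a2 z.2) +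
    tau `^ (1 - theta^-1) * (2 * N) `^ (2 - (a1 + a2)) * energy_integrand p theta s z.
Proof.
move=> /andP[th0 th1] a10 a20 as_ a2_ tau0 /andP[A1 AN] zA zN.
have fa0 := fourier_abs_ge0 p z; have fa2 := fourier_abs_le2 p z.
have E0 : 0 <= energy_integrand p theta s z by rewrite mulr_ge0 ?powR_ge0.
have t10 x : 0 <= trunc_power 1 0 x :> R by exact: trunc_power_ge0.
have tA0 x : 0 <= trunc_power A a1 x by exact: trunc_power_ge0.
have tN0 x : 0 <= trunc_power N a2 x by exact: trunc_power_ge0.
have third0 : 0 <= tau `^ (1 - theta^-1) * (2 * N) `^ (2 - (a1 + a2)) *
  energy_integrand p theta s z.
  by rewrite !mulr_ge0 ?powR_ge0.
have [z1|z1] := leP (enorm z) 1.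
  rewrite !(@trunc_power_in 1) ?(le_trans (enorm_ge1 z))// ?(le_trans (enorm_ge2 z))//.
  rewrite oppr0 !powRr0 !mulr1.
  apply: (@le_trans _ _ 4).
    rewrite (_ : 4 = 2 ^+ 2); last by ring.
    by rewrite ler_pXn2r ?nnegrE.
  by rewrite -addrA lerDl addr_ge0// !mulr_ge0// ltW.
have z0 : 0 < enorm z by exact: lt_trans z1.
set s' := a1 + a2 in as_ a2_ *.
have N0 : 0 < N by lra.
have lz0 : 0 < ln (enorm z) by rewrite ln_gt0.
apply: (@le_trans _ _ (tau * enorm z `^ (- s') +
    (tau * enorm z `^ (- s')) `^ (1 - theta^-1) * (fa p z ^+ 2) `^ (theta^-1))).
  apply: threshold_split; first exact: sqr_ge0.
    by rewrite mulr_gt0// powR_gt0.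
  by rewrite -[leLHS]invr1 lef_pV2 ?posrE.
apply: lerD.
  rewrite ler_wpDl ?mulr_ge0//.
  by rewrite ler_wpM2l ?(ltW tau0)// enorm_powN_le// ltW.
rewrite powRM ?(ltW tau0) ?powR_ge0// -!mulrA ler_wpM2l ?powR_ge0//.
rewrite /energy_integrand (_ : (fa p z ^+ 2) `^ theta^-1 = fa p z `^ (2 / theta));
  last first.
  by rewrite -powR_mulrn// -powRrM.
rewrite mulrC [leRHS]mulrCA ler_wpM2l ?powR_ge0//.
(* Splits off the weight of the energy; the remaining [|z|^(2 - s')] is at most [(2 N)^(2 - s')],
   since [|z| <= A + N <= 2 N]. *)
rewrite -powRrM. rewrite (_ : - s' * (1 - theta^-1) = (s' / theta - 2) + (2 - s'));
  last by ring.
rewrite gt0_powRD// [leLHS]mulrC.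
apply: ler_pM; rewrite ?powR_ge0//.
  rewrite ge0_ler_powR ?nnegrE ?enorm_ge0//; [lra|lra|].
  by apply: le_trans (enorm_le z) _; lra.
rewrite !powRE// ler_expR ler_wpM2r ?(ltW lz0)// lerD2r ler_wpM2r// invr_ge0.
exact: ltW.
Qed.

Lemma fourier_sq_le_zero (p s J A N a1 a2 : R) (z : plane R) :
  0 <= a1 -> 0 <= a2 -> a1 + a2 <= s -> 0 <= J ->
  fa p z ^+ 2 * enorm z `^ s <= J -> `|z.1| <= A -> `|z.2| <= N ->
  fa p z ^+ 2 <= 4 * (trunc_power 1 0 z.1 * trunc_power 1 0 z.2) +
    J * (trunc_power A a1 z.1 * trunc_power N a2 z.2).
Proof.
move=> a10 a20 as_ J0 hJ zA zN.
have fa0 := fourier_abs_ge0 p z; have fa2 := fourier_abs_le2 p z.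
have t10 x : 0 <= trunc_power 1 0 x :> R by exact: trunc_power_ge0.
have tA0 x : 0 <= trunc_power A a1 x by exact: trunc_power_ge0.
have tN0 x : 0 <= trunc_power N a2 x by exact: trunc_power_ge0.
have [z1|z1] := leP (enorm z) 1.
  rewrite !(@trunc_power_in 1) ?(le_trans (enorm_ge1 z))// ?(le_trans (enorm_ge2 z))//.
  rewrite oppr0 !powRr0 !mulr1.
  apply: (@le_trans _ _ 4).
    rewrite (_ : 4 = 2 ^+ 2); last by ring.
    by rewrite ler_pXn2r ?nnegrE.
  by rewrite lerDl !mulr_ge0.
have z0 : 0 < enorm z by exact: lt_trans z1.
apply: (@le_trans _ _ (J * enorm z `^ (- s))).
  by rewrite powRN -ler_pdivrMr ?invr_gt0 ?powR_gt0// invrK.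
rewrite ler_wpDl ?mulr_ge0// ler_wpM2l//.
apply: le_trans (enorm_powN_le _ _ (ltW z1) zA zN) => //.
have lz0 : 0 < ln (enorm z) by rewrite ln_gt0.
by rewrite !powRE// ler_expR ler_wpM2r ?(ltW lz0)// lerN2.
Qed.

Let mt (N a : R) : measurable_fun [set: TR] (fun x => (trunc_power N a x)%:E).
Proof. by apply/measurable_EFinP; exact: measurable_trunc_power. Qed.

Let t0 (N a : R) (x : TR) : (0 <= (trunc_power N a x)%:E)%E.
Proof. by rewrite lee_fin trunc_power_ge0. Qed.

Lemma measurable_plane_prod (F G : TR -> R) :
  measurable_fun [set: TR] F -> measurable_fun [set: TR] G ->
  measurable_fun [set: plane R] (fun z : plane R => F z.1 * G z.2).
Proof.
move=> mF mG; apply: measurable_funM.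
  exact: (measurableT_comp mF measurable_fst).
exact: (measurableT_comp mG measurable_snd).
Qed.

Lemma integral_trunc_prod (A N a1 a2 : R) : 1 <= A -> 1 <= N ->
  0 <= a1 < 1 -> 0 <= a2 < 1 ->
  (\int[(mu \x mu)%E]_(z in [set: plane R])
      (trunc_power A a1 z.1 * trunc_power N a2 z.2)%:E <=
   (2 / (1 - a1) * A `^ (1 - a1) * (2 / (1 - a2) * N `^ (1 - a2)))%:E)%E.
Proof.
move=> A1 N1 a1h a2h.
under eq_integral do rewrite EFinM.
rewrite (integral_plane_prod (mt A a1) (mt N a2))// EFinM.
apply: lee_pmul; rewrite ?integral_trunc_power//; apply: integral_ge0 => x _; exact: t0.
Qed.

Lemma integral_triangle_prod (A N : R) : 0 < A -> 0 < N ->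
  (\int[(mu \x mu)%E]_(z in [set: plane R])
      (triangle A z.1 * triangle N z.2)%:E = (A * N)%:E)%E.
Proof.
move=> A0 N0; under eq_integral do rewrite EFinM.
rewrite (@integral_plane_prod R (EFin \o triangle A) (EFin \o triangle N)) /=.
- by rewrite !integral_triangle1.
- by apply/measurable_EFinP; exact: measurable_triangle.
- by apply/measurable_EFinP; exact: measurable_triangle.
- by move=> x; rewrite lee_fin triangle_ge0.
- by move=> x; rewrite lee_fin triangle_ge0.
Qed.

(** The triangles are at most [1] and vanish off the box, so the pointwise bound is needed only
    there. [A * N] is the integral of the weight alone, and [16] is [4] times the area of
    [[-1, 1]^2]. *)
Lemma weighted_energy_le (p A N a1 a2 c : R) (E : plane R -> R) (J : R) :
  1 <= A -> 1 <= N -> 0 <= a1 < 1 -> 0 <= a2 < 1 -> 0 <= c ->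
  measurable_fun [set: plane R] E -> (forall z, 0 <= E z) ->
  (\int[(mu \x mu)%E]_(z in [set: plane R]) (E z)%:E <= J%:E)%E ->
  (forall z : plane R, `|z.1| <= A -> `|z.2| <= N ->
     fa p z ^+ 2 <= 4 * (trunc_power 1 0 z.1 * trunc_power 1 0 z.2) +
       c * (trunc_power A a1 z.1 * trunc_power N a2 z.2) + E z) ->
  (\int[(mu \x mu)%E]_(z in [set: plane R])
     (triangle A z.1 * triangle N z.2 * (1 + fa p z ^+ 2))%:E <=
   (A * N + (16 + c * (2 / (1 - a1) * A `^ (1 - a1) * (2 / (1 - a2) * N `^ (1 -
     a2))) + J))%:E)%E.
Proof.
move=> A1 N1 a1h a2h c0 mE E0 EJ hfa.
have A0 : 0 < A by lra.
have N0 : 0 < N by lra.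
pose F1 (z : plane R) := (triangle A z.1 * triangle N z.2)%:E.
pose F2 (z : plane R) := (4%:E * (trunc_power 1 0 z.1 * trunc_power 1 0 z.2)%:E)%E.
pose F3 (z : plane R) := (c%:E * (trunc_power A a1 z.1 * trunc_power N a2 z.2)%:E)%E.
have mP (M b M' b' : R) : measurable_fun [set: plane R]
    (fun z : plane R => (trunc_power M b z.1 * trunc_power M' b' z.2)%:E).
  apply/measurable_EFinP; apply: measurable_plane_prod; exact: measurable_trunc_power.
have P0 (M b M' b' : R) (z : plane R) :
    (0 <= (trunc_power M b z.1 * trunc_power M' b' z.2)%:E)%E.
  by rewrite lee_fin mulr_ge0 ?trunc_power_ge0.
have mF1 : measurable_fun [set: plane R] F1.
  by apply/measurable_EFinP; apply: measurable_plane_prod; exact: measurable_triangle.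
have mF2 : measurable_fun [set: plane R] F2 by exact: measurable_funeM.
have mF3 : measurable_fun [set: plane R] F3 by exact: measurable_funeM.
have mE' : measurable_fun [set: plane R] (EFin \o E) by exact/measurable_EFinP.
have F10 z : (0 <= F1 z)%E by rewrite lee_fin mulr_ge0 ?triangle_ge0.
have F20 z : (0 <= F2 z)%E by rewrite mule_ge0// lee_fin.
have F30 z : (0 <= F3 z)%E by rewrite mule_ge0// lee_fin.
have E'0 z : (0 <= (EFin \o E) z)%E by rewrite lee_fin.
apply: (@le_trans _ _ (\int[(mu \x mu)%E]_(z in [set: plane R])
    (F1 z + (F2 z + F3 z + (EFin \o E) z)))%E).
  apply: ge0_le_integral => //.
  - by move=> z _; rewrite lee_fin !mulr_ge0 ?triangle_ge0// addr_ge0// sqr_ge0.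
  - apply/measurable_EFinP; apply: measurable_funM.
      by apply: measurable_plane_prod; exact: measurable_triangle.
    apply: measurable_funD => //; apply: measurable_funX.
    exact: measurable_fourier_abs.
  - by repeat apply: emeasurable_funD.
  - move=> z _; rewrite /F1 /F2 /F3 /= -!EFinM -!EFinD lee_fin mulrDr mulr1 lerD2l.
    have R0 : 0 <= 4 * (trunc_power 1 0 z.1 * trunc_power 1 0 z.2) +
       c * (trunc_power A a1 z.1 * trunc_power N a2 z.2) + E z.
      by rewrite !addr_ge0 ?mulr_ge0 ?trunc_power_ge0.
    have [zA|zA] := leP `|z.1| A; last by rewrite triangle_out// !mul0r.
    have [zN|zN] := leP `|z.2| N; last by rewrite (triangle_out N0)// mulr0 mul0r.
    apply: le_trans (hfa z zA zN); rewrite ler_piMl ?sqr_ge0//.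
    by rewrite -[leRHS]mulr1 ler_pM ?triangle_ge0 ?triangle_le1.
have mF23 : measurable_fun [set: plane R] (fun z => F2 z + F3 z)%E by exact:
  emeasurable_funD.
have F230 z : (0 <= F2 z + F3 z)%E by rewrite adde_ge0.
rewrite ge0_integralD//; last 2 first.
- by move=> z _; rewrite !adde_ge0.
- exact: emeasurable_funD.
rewrite ge0_integralD// ge0_integralD// integral_triangle_prod// EFinD leeD2l//.
rewrite EFinD leeD// EFinD leeD//.
  rewrite ge0_integralZl//.
  rewrite (_ : 16%:E = (4%:E * 4%:E)%E); last by rewrite -EFinM; congr EFin; ring.
  apply: lee_wpmul2l => //.
  apply: le_trans (integral_trunc_prod _ _ _ _) _; rewrite ?lexx ?ltr01//.
  by rewrite lee_fin !subr0 !powR1; lra.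
rewrite ge0_integralZl// EFinM; apply: lee_wpmul2l; first by rewrite lee_fin.
exact: integral_trunc_prod.
Qed.

End BoxUpper.

(** * From finite energy to an inequality for every box *)

Section EnergyBound.
Context {R : realType}.
Notation mu := (@lebesgue_measure R).
Notation TR := (measurableTypeR R).
Notation fa p := (fourier_abs (@lift_lebesgue R p)).

Lemma powR_growth (c C k k' : R) : 0 < c -> k' < k ->
  ~ (forall N : R, 1 <= N -> c * N `^ k <= C * N `^ k').
Proof.
move=> c0 kk H.
(* Chosen so that [c (k - k') M = |C|]: at [N = exp M], [exp x >= 1 + x] gives
   [c N^(k - k') >= c + |C| > C]. *)
pose M := `|C| / (c * (k - k')).
have kk0 : 0 < k - k' by rewrite subr_gt0.
have M0 : 0 <= M by rewrite divr_ge0// mulr_ge0// ltW.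
have := H (expR M); rewrite -[leLHS]expR0 ler_expR => /(_ M0).
rewrite !powRE ?expR_gt0// expRK.
rewrite -ler_pdivrMr ?expR_gt0// -mulrA -expRN -expRD => h.
have : 1 + (k - k') * M <= expR (k * M - k' * M).
  by rewrite -mulrBl; exact: expR_ge1Dx.
have cM : c * ((k - k') * M) = `|C|.
  by rewrite /M mulrA mulrC divfK// gt_eqF// mulr_gt0.
have := ler_norm C.
move=> h1 h2; have : c * (1 + (k - k') * M) <= c * expR (k * M - k' * M).
  by rewrite ler_pM2l.
rewrite mulrDr mulr1 cM; lra.
Qed.

Lemma measurable_energy_integrand (p theta s : R) :
  measurable_fun [set: plane R] (energy_integrand p theta s).
Proof.
apply: measurable_funM.
  exact: (measurableT_comp (measurable_powR _) (measurable_fourier_abs p)).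
exact: (measurableT_comp (measurable_powR _) (@measurable_enorm R)).
Qed.

Lemma energy_integrand_ge0 (p theta s : R) z : 0 <= energy_integrand p theta s z.
Proof. by rewrite mulr_ge0 ?powR_ge0. Qed.

(** [J] is fixed before the box, so letting [N] grow constrains [s]. The terms [A * N] of the lower
    and upper bounds cancel. The coefficient [tau + J] dominates both the [J] arising for
    [theta = 0] and the [tau] arising for [theta > 0]. *)
Lemma energy_box_inequality (p theta s : R) : 1 < p -> 0 <= theta <= 1 ->
  (energy s theta (@lift_lebesgue R p) < +oo)%E ->
  exists2 J : R, 0 <= J & forall a1 a2 A N L r tau : R,
    0 <= a1 < 1 -> 0 <= a2 < 1 -> a1 + a2 <= s -> 1 <= A <= N -> 0 < tau ->
    0 < L -> 0 < r -> L + r <= 1 -> 2 * pi * r * A <= 2^-1 ->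
    2 * pi * (p * (L + r) `^ (p - 1) * r) * N <= 2^-1 ->
    A * N * (L * r / 4) <= 16 +
      (tau + J) * (2 / (1 - a1) * A `^ (1 - a1) * (2 / (1 - a2) * N `^ (1 - a2))) +
      (if theta == 0 then 0 else
         tau `^ (1 - theta^-1) * (2 * N) `^ (2 - (a1 + a2)) * J).
Proof.
move=> p1 /andP[th0 th1] hE.
(* What the two cases share: they differ in the error term [E], its integral bound [J] and the
   coefficient [c]. *)
have body (E : R -> R -> R -> plane R -> R) (c : R -> R) (J : R -> R -> R -> R) :
  forall a1 a2 A N L r tau : R,
    0 <= a1 < 1 -> 0 <= a2 < 1 -> a1 + a2 <= s -> 1 <= A <= N -> 0 < tau ->
    0 < L -> 0 < r -> L + r <= 1 -> 2 * pi * r * A <= 2^-1 ->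
    2 * pi * (p * (L + r) `^ (p - 1) * r) * N <= 2^-1 ->
    0 <= c tau ->
    measurable_fun [set: plane R] (E tau N (a1 + a2)) ->
    (forall z, 0 <= E tau N (a1 + a2) z) ->
    (\int[(mu \x mu)%E]_(z in [set: plane R]) (E tau N (a1 + a2) z)%:E <=
       (J tau N (a1 + a2))%:E)%E ->
    (forall z : plane R, `|z.1| <= A -> `|z.2| <= N ->
     fa p z ^+ 2 <= 4 * (trunc_power 1 0 z.1 * trunc_power 1 0 z.2) +
       c tau * (trunc_power A a1 z.1 * trunc_power N a2 z.2) + E tau N (a1 + a2) z) ->
    A * N * (L * r / 4) <= 16 +
      c tau * (2 / (1 - a1) * A `^ (1 - a1) * (2 / (1 - a2) * N `^ (1 - a2))) +
      J tau N (a1 + a2).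
  move=> a1 a2 A N L r tau a1h a2h as_ AN tau0 L0 r0 Lr rA rN c0 mE E0 EJ hfa.
  have /andP[A1 AN'] := AN.
  have N1 : 1 <= N by exact: le_trans AN'.
  have Ap : 0 < A by lra.
  have Np : 0 < N by lra.
  have := weighted_energy_ge p1 Ap Np L0 r0 Lr rA rN.
  move=> /le_trans /(_ (weighted_energy_le A1 N1 a1h a2h c0 mE E0 EJ hfa)).
  by rewrite lee_fin mulrDr mulr1 lerD2l.
have [theta0|thetaN] := eqVneq theta 0.
  pose J := fine (energy s theta (@lift_lebesgue R p)).
  have hz z : ((fa p z ^+ 2 * enorm z `^ s)%:E <= energy s theta (@lift_lebesgue R
    p))%E.
    by rewrite /energy theta0 eqxx; apply: ereal_sup_ubound; exists z.
  have eps0 : (0 <= energy s theta (@lift_lebesgue R p))%E.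
    by apply: le_trans (hz (0, 0)); rewrite lee_fin mulr_ge0 ?sqr_ge0 ?powR_ge0.
  have JE : (J%:E = energy s theta (@lift_lebesgue R p))%E.
    by rewrite /J fineK// ge0_fin_numE.
  have J0 : 0 <= J by rewrite -lee_fin JE.
  exists J => // a1 a2 A N L r tau a1h a2h as_ AN tau0 L0 r0 Lr rA rN.
  have /andP[a10 _] := a1h; have /andP[a20 _] := a2h.
  apply: (@le_trans _ _ (16 + J * (2 / (1 - a1) * A `^ (1 - a1) *
      (2 / (1 - a2) * N `^ (1 - a2))) + 0)).
    apply: (body (fun _ _ _ _ => 0) (fun _ => J) (fun _ _ _ => 0) a1 a2 A N L r
      tau) => //.
    - by rewrite integral0.
    - move=> z zA zN; rewrite addr0; apply: fourier_sq_le_zero as_ _ _ _ _ => //.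
      by rewrite -lee_fin JE.
  rewrite lerD2r lerD2l ler_wpM2r ?lerDr ?(ltW tau0)//.
  have /andP[_ a11] := a1h; have /andP[_ a21] := a2h.
  by rewrite !mulr_ge0 ?powR_ge0 ?invr_ge0 ?subr_ge0// ltW.
have thp : 0 < theta by rewrite lt_neqAle eq_sym thetaN.
pose X := (\int[(mu \x mu)%E]_(z in [set: plane R]) (energy_integrand p theta s
  z)%:E)%E.
have X0 : (0 <= X)%E.
  by apply: integral_ge0 => z _; rewrite lee_fin energy_integrand_ge0.
have Xoo : (X < +oo)%E.
  by move: hE; rewrite /energy (negbTE thetaN); exact: lty_poweRy.
pose J := fine X.
have JE : (J%:E = X)%E by rewrite /J fineK// ge0_fin_numE.
have J0 : 0 <= J by rewrite -lee_fin JE.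
exists J => // a1 a2 A N L r tau a1h a2h as_ AN tau0 L0 r0 Lr rA rN.
have /andP[a10 a11] := a1h; have /andP[a20 a21] := a2h.
pose K (tau N a : R) := tau `^ (1 - theta^-1) * (2 * N) `^ (2 - a).
have K0 x y w : 0 <= K x y w by rewrite mulr_ge0 ?powR_ge0.
apply: (@le_trans _ _ (16 + tau * (2 / (1 - a1) * A `^ (1 - a1) *
    (2 / (1 - a2) * N `^ (1 - a2))) + K tau N (a1 + a2) * J)).
  apply: (body (fun tau N a z => K tau N a * energy_integrand p theta s z)
     (fun tau => tau) (fun tau N a => K tau N a * J) a1 a2 A N L r tau) => //.
  - exact: ltW.
  - by apply: measurable_funM => //; exact: measurable_energy_integrand.
  - by move=> z; rewrite mulr_ge0// energy_integrand_ge0.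
  - under eq_integral do rewrite EFinM.
    rewrite ge0_integralZl//.
    + by rewrite [leRHS]EFinM JE.
    + by apply/measurable_EFinP; exact: measurable_energy_integrand.
    + by move=> z _; rewrite lee_fin energy_integrand_ge0.
    + by rewrite lee_fin.
  - move=> z zA zN; apply: fourier_sq_le_pos => //; [by rewrite thp|lra].
rewrite lerD2r lerD2l ler_wpM2r ?lerDl//.
by rewrite !mulr_ge0 ?powR_ge0 ?invr_ge0 ?subr_ge0// ltW.
Qed.

End EnergyBound.

(** * Upper bounds for exponents of finite energy *)

Section Spectrum.
Context {R : realType}.

Lemma powR_ge1 (N k : R) : 1 <= N -> 0 <= k -> 1 <= N `^ k.
Proof.
move=> N1 k0; rewrite powRE; last exact: lt_le_trans N1.
by rewrite -[leLHS]expR0 ler_expR mulr_ge0// ln_ge0.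
Qed.

(** With [A = N], [L = 1/2], [tau = 1] and [r] of order [1 / N], the box inequality bounds a
    multiple of [N] by a multiple of [N^(2 - 2a)], impossible once [2 a > 1]. *)
Lemma energy_lty_le1 (p theta s : R) : 1 < p -> 0 <= theta <= 1 ->
  (energy s theta (@lift_lebesgue R p) < +oo)%E -> s <= 1.
Proof.
move=> p1 th hE; rewrite leNgt; apply/negP => s1.
have [J J0 key] := energy_box_inequality p1 th hE.
have pi0 : 0 < pi :> R by exact: pi_gt0.
have pi2 : 2 <= pi :> R by exact: pi_ge2.
move: (@pi R) pi0 pi2 key => P pi0 pi2 key.
(* The cap [3 / 2], any value strictly between [1] and [2], keeps [a < 1] as well as [2 a > 1]. *)
set a := Num.min s (3 / 2) / 2.
have a12 : 2^-1 < a by rewrite /a ltr_pdivlMr// mulVf// lt_min s1/=; lra.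
have a34 : a < 1.
  by rewrite /a ltr_pdivrMr// mul1r (@le_lt_trans _ _ (3 / 2))// ?ge_min ?lexx
    ?orbT//; lra.
have as_ : a + a <= s.
  by rewrite (_ : a + a = Num.min s (3 / 2)) ?ge_min ?lexx// /a; field.
apply: (@powR_growth R (32 * P * p)^-1
   (16 + (1 + J) * (2 / (1 - a)) ^+ 2 + 2 `^ (2 - (a + a)) * J) 1 (2 - (a + a))).
- by rewrite invr_gt0 !mulr_gt0//; lra.
- lra.
move=> N N1; have N0 : 0 < N by lra.
have pp0 : 0 < 4 * P * p * N by rewrite !mulr_gt0//; lra.
(* As [L + r <= 1], the slope of [x^p] is at most [p], and this [r] meets both proximity
   conditions. *)
pose r := (4 * P * p * N)^-1.
have r0 : 0 < r by rewrite invr_gt0.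
have r2 : r <= 2^-1.
  rewrite lef_pV2 ?posrE//.
  have h : 1 * 1 <= P * p by apply: ler_pM; lra.
  have : 1 * 1 <= P * p * N by apply: ler_pM; lra.
  lra.
have pi_n0 : P != 0 :> R by rewrite gt_eqF.
have p_n0 : p != 0 by rewrite gt_eqF//; lra.
have N_n0 : N != 0 by rewrite gt_eqF.
have rN : 2 * P * p * r * N = 2^-1.
  by rewrite /r; field; rewrite N_n0 p_n0 pi_n0.
have h1 : 2 * P * r * N <= 2^-1.
  rewrite -rN ler_wpM2r ?(ltW N0)// ler_wpM2r ?(ltW r0)// ler_peMr ?(ltW p1)//; lra.
have h2 : 2 * P * (p * (2^-1 + r) `^ (p - 1) * r) * N <= 2^-1.
  rewrite -rN ler_wpM2r ?(ltW N0)// !mulrA ler_wpM2r ?(ltW r0)// ler_piMr//.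
    by rewrite !mulr_ge0//; lra.
  rewrite [leRHS](_ : 1 = 1 `^ (p - 1)); last by rewrite powR1.
  by rewrite ge0_ler_powR ?nnegrE//; lra.
have aa : 0 <= a < 1 by apply/andP; split; lra.
have NN : 1 <= N <= N by rewrite N1 lexx.
have Lr : 2^-1 + r <= 1 by lra.
have := key a a N N 2^-1 r 1 aa aa as_ NN ltr01 (_ : 0 < 2^-1) r0 Lr h1 h2.
rewrite invr_gt0 ltr0n => /(_ isT).
rewrite (_ : N * N * (2^-1 * r / 4) = (32 * P * p)^-1 * N `^ 1); last first.
  by rewrite powRr1 ?(ltW N0)// /r; field; rewrite N_n0 p_n0 pi_n0.
move/le_trans; apply.
rewrite [leRHS]mulrDl [X in _ <= X + _]mulrDl.
have Nk1 : 1 <= N `^ (2 - (a + a)) by apply: powR_ge1 => //; lra.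
apply: lerD; first apply: lerD.
- by rewrite ler_peMr.
- rewrite le_eqVlt; apply/orP; left; apply/eqP.
  rewrite (_ : 2 - (a + a) = (1 - a) + (1 - a)); last by ring.
  by rewrite (gt0_powRD (1 - a) (1 - a) N0); ring.
case: ifP => _; first by rewrite !mulr_ge0 ?powR_ge0.
by rewrite powR1 mul1r powRM ?(ltW N0)// -!mulrA (mulrC J).
Qed.

Lemma energy_lty_le (p theta s : R) : 1 < p -> 0 <= theta <= 1 ->
  2 / p + theta * (1 - 1 / p) < 1 ->
  (energy s theta (@lift_lebesgue R p) < +oo)%E ->
  s <= 2 / p + theta * (1 - 1 / p).
Proof.
move=> p1 th cp1 hE; rewrite leNgt; apply/negP => cps.
have [J J0 key] := energy_box_inequality p1 th hE.
have pi0 : 0 < pi :> R by exact: pi_gt0.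
have pi2 : 2 <= pi :> R by exact: pi_ge2.
move: (@pi R) pi0 pi2 key => P pi0 pi2 key.
have p0 : 0 < p by lra.
have p_n0 : p != 0 by rewrite gt_eqF.
have pi_n0 : P != 0 :> R by rewrite gt_eqF.
have /andP[th0 th1] := th.
have pV1 : p^-1 < 1 by rewrite invf_lt1.
have pV0 : 0 < p^-1 by rewrite invr_gt0.
have tp : 0 <= theta * (1 - 1 / p) by rewrite mulr_ge0// div1r; lra.
set cp := 2 / p + theta * (1 - 1 / p) in cp1 cps *.
(* Strictly between [cp] and [1]; the whole exponent goes to the second coordinate, the long side of
   the box. *)
set a := Num.min s ((1 + cp) / 2).
have a1 : a < 1 by rewrite /a gt_min; apply/orP; right; lra.
have cpa : cp < a by rewrite lt_min cps/=; lra.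
have cp0 : 0 < cp by rewrite /cp ltr_wpDr// divr_gt0.
have as_ : 0 + a <= s by rewrite add0r ge_min lexx.
(* The power of [N] reached by both growing terms on the right; [cp < a] says [k' < 1 - 1/p]. *)
set k' := theta * (1 - 1 / p) + p^-1 + 1 - a.
have k'0 : 0 <= k' by rewrite /k'; lra.
(* With [L = r = c0 / A] the left sides of both proximity conditions are at most
   [2 P p c0 = 1/4]. *)
pose c0 : R := (8 * P * p)^-1.
have c00 : 0 < c0 by rewrite invr_gt0 !mulr_gt0.
have c0E : 8 * P * p * c0 = 1 by rewrite mulfV// !mulf_neq0.
have c02 : 2 * c0 <= 1.
  have : 0 <= (8 * P * p - 2) * c0.
    rewrite mulr_ge0 ?(ltW c00)// subr_ge0.
    have h : 2 * 1 <= P * p by apply: ler_pM; lra.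
    lra.
  by move: c0E; lra.
apply: (@powR_growth R (c0 ^+ 2 / 4)
   (16 + (1 + J) * (2 * (2 / (1 - a))) + 2 `^ (2 - (0 + a)) * J) (1 - p^-1) k').
- by rewrite divr_gt0// exprn_gt0.
- by rewrite /k'; move: cpa; rewrite /cp; lra.
move=> N N1; have N0 : 0 < N by lra.
have lN0 : 0 <= ln N by rewrite ln_ge0.
pose A := N `^ p^-1.
have A0 : 0 < A by exact: powR_gt0.
have A1 : 1 <= A by apply: powR_ge1 => //; exact: ltW.
have A_n0 : A != 0 by rewrite gt_eqF.
have AN : A <= N.
  rewrite /A powRE// -[leRHS](lnK N0) ler_expR ler_piMl//; exact: ltW.
have Ap : A `^ p = N by rewrite /A -powRrM mulVf// powRr1// ltW.
pose r := c0 / A.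
have r0 : 0 < r by rewrite divr_gt0.
have rr : r + r = 2 * c0 / A by rewrite /r; ring.
have Lr : r + r <= 1.
  by rewrite rr ler_pdivrMr// mul1r (le_trans c02).
have h1 : 2 * P * r * A <= 2^-1.
  rewrite (_ : 2 * P * r * A = 2 * P * c0); last by rewrite /r; field.
  have : 0 <= (p - 1) * (P * c0) by rewrite !mulr_ge0 ?(ltW c00)//; lra.
  by move: c0E; lra.
have h2 : 2 * P * (p * (r + r) `^ (p - 1) * r) * N <= 2^-1.
  rewrite (_ : 2 * P * _ * N = P * p * ((r + r) * (r + r) `^ (p - 1)) * N);
    last by ring.
  rewrite mulr_powRB1; [|lra|lra].
  rewrite rr powRM ?invr_ge0 ?(ltW A0) ?mulr_ge0 ?(ltW c00)//.
  rewrite -[A^-1]powR_inv1 ?(ltW A0)// -powRrM mulN1r powRN Ap.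
  rewrite -!mulrA mulVf ?gt_eqF// mulr1.
  have : (2 * c0) `^ p <= 2 * c0.
    have c020 : 0 < 2 * c0 by rewrite mulr_gt0.
    rewrite powRE// -[leRHS](lnK c020) ler_expR.
    have l0 : ln (2 * c0) <= 0 by exact: ln_le0.
    have : 0 <= (p - 1) * (- ln (2 * c0)) by rewrite mulr_ge0//; lra.
    lra.
  move=> h; have : P * (p * (2 * c0) `^ p) <= P * (p * (2 * c0)).
    by rewrite !ler_wpM2l ?(ltW p0) ?(ltW pi0).
  by move: c0E; lra.
have aa : 0 <= a < 1 by apply/andP; split; lra.
have oo : 0 <= (0 : R) < 1 by rewrite lexx ltr01.
have ANN : 1 <= A <= N by rewrite A1 AN.
(* For [theta > 0] this makes [tau A N^(1 - a)] and [tau^(1 - 1/theta) N^(2 - a)] the same power of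
   [N]. *)
pose tau := N `^ (theta * (1 - 1 / p)).
have tau0 : 0 < tau by exact: powR_gt0.
have tau1 : 1 <= tau by exact: powR_ge1.
have := key 0 a A N r r tau oo aa as_ ANN tau0 r0 r0 Lr h1 h2.
rewrite (_ : A * N * (r * r / 4) = (c0 ^+ 2 / 4) * N `^ (1 - p^-1)); last first.
  rewrite gt0_powRD// powRr1 ?(ltW N0)// powRN -/A /r; field; exact: A_n0.
move/le_trans; apply.
rewrite [leRHS]mulrDl [X in _ <= X + _]mulrDl.
have Nk1 : 1 <= N `^ k' by exact: powR_ge1.
have Nk : tau * (A * N `^ (1 - a)) = N `^ k'.
  rewrite /tau /A -!gt0_powRD//; congr (_ `^ _); rewrite /k'; ring.
apply: lerD; first apply: lerD.
- by rewrite ler_peMr.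
- apply: (@le_trans _ _ ((1 + J) * tau * (2 * A * (2 / (1 - a) * N `^ (1 - a))))).
    rewrite subr0 invr1 mulr1 powRr1 ?(ltW A0)//.
    apply: ler_wpM2r; first by rewrite !mulr_ge0 ?powR_ge0 ?invr_ge0 ?subr_ge0// ltW.
    by rewrite mulrDl mul1r lerD2l ler_peMr.
  by rewrite -Nk le_eqVlt; apply/orP; left; apply/eqP; ring.
case: ifPn => [_|thN]; first by rewrite !mulr_ge0 ?powR_ge0.
rewrite powRM ?(ltW N0)//.
rewrite [leRHS](_ : _ = 2 `^ (2 - (0 + a)) * N `^ k' * J); last by ring.
rewrite ler_wpM2r// mulrCA ler_wpM2l ?powR_ge0// /tau -powRrM -gt0_powRD//.
rewrite le_eqVlt; apply/orP; left; apply/eqP; congr (_ `^ _).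
by rewrite /k'; field; rewrite p_n0 thN.
Qed.

End Spectrum.

(** * The Fourier spectrum *)

Section Main.
Context {R : realType}.

Lemma energy_lty_lt (p theta s : R) : 1 < p -> 0 < theta <= 1 -> 0 < s ->
  s < Num.min (2 / p + theta * (1 - 1 / p)) 1 ->
  (energy s theta (@lift_lebesgue R p) < +oo)%E.
Proof.
move=> p1 /andP[th0 th1] s0; rewrite lt_min => /andP[sp s1].
have p0 : 0 < p by lra.
have p_n0 : p != 0 by rewrite gt_eqF.
have [p2|p2] := leP p 2.
  have qE : Num.max p 2 = 2 by rewrite max_r.
  by apply: (@energy_lty R p theta s 0) => //; rewrite ?qE; lra.
have qE : Num.max p 2 = p by rewrite max_l// ltW.
pose b := (p - 2) / (2 * (p - 1)).
have pm0 : 0 < 2 * (p - 1) by rewrite mulr_gt0//; lra.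
have b0 : 0 <= b by rewrite divr_ge0//; lra.
have bE : 2 * b * (p - 1) = p - 2 by rewrite /b; field; lra.
(* Makes [2 v < theta] strict. The first entry keeps [v >= 0]; the second makes the loss
   [2 e (1 - 1/p)] smaller than the gap above [s]. *)
pose e := Num.min (theta / 2) ((2 / p + theta * (1 - 1 / p) - s) / 4).
have e0 : 0 < e.
  by rewrite lt_min divr_gt0//= divr_gt0// subr_gt0.
have e1 : e <= theta / 2 by rewrite ge_min lexx.
have e2 : e <= (2 / p + theta * (1 - 1 / p) - s) / 4 by rewrite ge_min lexx orbT.
have pV1 : p^-1 < 1 by rewrite invf_lt1.
have pV0 : 0 < p^-1 by rewrite invr_gt0.
pose v := Num.min b (theta / 2 - e).
have v0 : 0 <= v by rewrite le_min b0/=; lra.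
have vb : v <= b by rewrite ge_min lexx.
have vt : v <= theta / 2 - e by rewrite ge_min lexx orbT.
apply: (@energy_lty R p theta s v) => //; rewrite ?qE.
- rewrite -bE ler_wpM2r//; lra.
- lra.
- rewrite (_ : 2 * ((1 - v) / p) + 2 * v = 2 / p + 2 * v * (1 - p^-1)); last by ring.
  have [vE|vE] : v = b \/ v = theta / 2 - e.
    by rewrite /v; case: (leP b (theta / 2 - e)); [left|right].
  + rewrite vE (_ : 2 / p + 2 * b * (1 - p^-1) = 1)//.
    by rewrite /b; field; rewrite p_n0; lra.
  + rewrite vE; have : 0 <= e * p^-1 by rewrite mulr_ge0 ?(ltW e0) ?(ltW pV0).
    rewrite div1r in sp e2; lra.
Qed.

Lemma energy_lty_lt0 (p : R) : 1 < p ->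
  (energy (Num.min (2 / p) 1)%R 0%R (@lift_lebesgue R p) < +oo)%E.
Proof.
move=> p1; rewrite (_ : Num.min (2 / p) 1 = 2 / Num.max p 2); first exact: energy0_lty.
have p0 : 0 < p by lra.
have [p2|p2] := leP p 2.
  by rewrite min_r ?divff// ler_pdivlMr// mul1r.
by rewrite min_l// ler_pdivrMr// mul1r ltW.
Qed.

End Main.

Theorem theorem5p1 (R : realType) (p : R) (hp : 1 < p)
    (theta : R) (htheta : 0 <= theta <= 1) :
  fourier_spectrum theta (lift_lebesgue p) =
  (Num.min (2 / p + theta * (1 - 1 / p)) 1)%:E.
Proof.
set d := Num.min _ _.
have pV1 : p^-1 < 1 by rewrite invf_lt1//; lra.
have pV0 : 0 < p^-1 by rewrite invr_gt0; lra.
have /andP[th0 th1] := htheta.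
have d0 : 0 < d.
  rewrite lt_min ltr01 andbT ltr_pwDl ?divr_gt0//; first lra.
  by rewrite mulr_ge0// div1r; lra.
rewrite /fourier_spectrum; set S := [set s | _].
have S_le s : S s -> s <= d.
  move=> [s0 hE]; rewrite /d le_min (energy_lty_le1 hp htheta hE) andbT.
  have [cp1|cp1] := ltP (2 / p + theta * (1 - 1 / p)) 1.
    exact: energy_lty_le.
  exact: le_trans (energy_lty_le1 hp htheta hE) cp1.
(* At [theta = 0] the witness is the endpoint [d], for [theta > 0] it is [s] itself; either suffices
   for the supremum. *)
have S_ge s : 0 < s -> s < d -> exists2 s', S s' & s <= s'.
  move=> s0 sd; have [t0|tn0] := eqVneq theta 0.
    exists d; last exact: ltW.
    split; first exact: ltW.
    by rewrite /d t0 mul0r addr0; exact: energy_lty_lt0.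
  exists s => //; split; first exact: ltW.
  apply: energy_lty_lt => //.
  by rewrite th1 andbT lt_neqAle eq_sym tn0.
have d20 : 0 < d / 2 by rewrite divr_gt0.
have d2d : d / 2 < d by lra.
case: ifPn => [/eqP S0|_].
  have [s' + _] := S_ge _ d20 d2d.
  by rewrite S0.
apply/eqP; rewrite eq_le; apply/andP; split.
  by apply: ge_ereal_sup => _ [s Ss <-]; rewrite lee_fin S_le.
apply/lee_addgt0Pr => e e0.
(* The maximum keeps [s] positive when [e] is large. *)
pose s := Num.max (d - e) (d / 2).
have s0 : 0 < s by rewrite lt_max d20 orbT.
have sd : s < d by rewrite gt_max d2d andbT; lra.
have [s' Ss' ss'] := S_ge _ s0 sd.
apply: (@le_trans _ _ (s' + e)%:E).
  rewrite lee_fin -lerBlDr (le_trans _ ss')// /s le_max lexx//.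
by rewrite EFinD leeD2r//; apply: ereal_sup_ubound; exists s'.
Qed.
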